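(* If $0<q<\min\{p,2\}$, then there exists a function $f\in(\mathcal D^p_{p-1}\cap H^\infty)\setminus(\mathcal D^q_{q-1}\cap H^\infty)$.
   Context: $\mathbb D$ is the open unit disc, $dA=\frac1\pi dx\,dy$. For $0<p<\infty$, $\mathcal D^p_{p-1}$ is the space of analytic $f$ in $\mathbb D$ with $\int_{\mathbb D}(1-|z|)^{p-1}|f'(z)|^p\,dA(z)<\infty$. $H^\infty$ is the space of bounded analytic functions on $\mathbb D$. *)

(* Defs.v *)
From Stdlib Require Import Reals.
Open Scope R_scope.

Definition Cpx : Type := (R * R)%type.
Definition Cadd (z w : Cpx) : Cpx := (fst z + fst w, snd z + snd w).
Definition Csub (z w : Cpx) : Cpx := (fst z - fst w, snd z - snd w).
Definition Cmul (z w : Cpx) : Cpx :=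
  (fst z * fst w - snd z * snd w, fst z * snd w + snd z * fst w).
Definition Cnorm (z : Cpx) : R := sqrt (fst z ^ 2 + snd z ^ 2).

Definition in_disc (z : Cpx) : Prop := Cnorm z < 1.

Definition has_cderiv (f : Cpx -> Cpx) (z d : Cpx) : Prop :=
  forall eps, 0 < eps -> exists delta, 0 < delta /\
    forall h : Cpx, 0 < Cnorm h < delta ->
      Cnorm (Csub (Csub (f (Cadd z h)) (f z)) (Cmul h d)) <= eps * Cnorm h.

Definition rpow (x a : R) : R :=
  if Rle_dec x 0 then 0 else Rpower x a.

Fixpoint sumR (n : nat) (u : nat -> R) : R :=
  match n with O => 0 | S m => sumR m u + u m end.

(** Finiteness of  \int_D g dA  (dA = dx dy / pi) for a nonnegative
    (continuous) g on D: the lower (inner) integral, i.e. the supremum of the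
    integrals of nonnegative step functions below g supported on finitely many
    closed rectangles contained in D with pairwise disjoint interiors, is finite. *)
Record cell := mkCell { ca : R; cb : R; cc : R; cd : R; cv : R }.

Definition valid_cell (g : Cpx -> R) (k : cell) : Prop :=
  ca k < cb k /\ cc k < cd k /\ 0 <= cv k /\
  forall x y, ca k <= x <= cb k -> cc k <= y <= cd k ->
    in_disc (x, y) /\ cv k <= g (x, y).

Definition cells_disjoint (k1 k2 : cell) : Prop :=
  cb k1 <= ca k2 \/ cb k2 <= ca k1 \/ cd k1 <= cc k2 \/ cd k2 <= cc k1.

Definition finite_disc_integral (g : Cpx -> R) : Prop :=
  exists M : R, forall (n : nat) (K : nat -> cell),
    (forall i, (i < n)%nat -> valid_cell g (K i)) ->
    (forall i j, (i < n)%nat -> (j < n)%nat -> i <> j ->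
        cells_disjoint (K i) (K j)) ->
    sumR n (fun i => cv (K i) * (cb (K i) - ca (K i)) * (cd (K i) - cc (K i)) / PI)
      <= M.

Definition analytic_with_deriv (f f' : Cpx -> Cpx) : Prop :=
  forall z, in_disc z -> has_cderiv f z (f' z).

Definition in_Dp (p : R) (f : Cpx -> Cpx) : Prop :=
  exists f' : Cpx -> Cpx, analytic_with_deriv f f' /\
    finite_disc_integral
      (fun z => rpow (1 - Cnorm z) (p - 1) * rpow (Cnorm (f' z)) p).

Definition in_Hinf (f : Cpx -> Cpx) : Prop :=
  (exists f' : Cpx -> Cpx, analytic_with_deriv f f') /\
  exists M : R, forall z, in_disc z -> Cnorm (f z) <= M.

(* Main.v *)
(** Run a Rudin-Shapiro type recursion with lacunary frequencies [m_k = L^k] and coefficients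
    [a_k = (k+1)^(-1/q)]:
      [P_(k+1) = P_k + a_k R_k],  [R_(k+1) = z^(m_(k+1)) (R_k - a_k P_k)].
    Pointwise on the disc, [|P_(k+1)|^2 + |R_(k+1)|^2 <= (1 + a_k^2) (|P_k|^2 + |R_k|^2)], and
    [sum a_k^2] converges because [q < 2]; so [f = lim P_k] is bounded and analytic.
    Near [1 - |z| = 1/m_k] the derivative of [f] has size at most [a_k m_k] up to constants, so
    [(1-|z|)^(p-1) |f'|^p] is dominated by [1/((1-|z|) log(1/(1-|z|))^(p/q))], which is integrable
    over the disc since [p > q].
    For the lower bound take both initial values [(P_0, R_0) = (0, 1)] and [(1, 0)], with limits
    [f] and [h]. The 2x2 determinant of the two solutions is multiplied at each step by
    [(1 + a_k^2) z^(m_(k+1))], so it is bounded below on the [k]-th annulus; since the [P_k] are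
    bounded, the two [R_k] cannot both be small, whence [|f'| + |h'| >= c a_k m_k] there if [L] is
    large. Summing [a_k^q = 1/(k+1)] over [k] shows that [f] and [h] are not both in [D^q_(q-1)]. *)

Require Import Defs.
From Stdlib Require Import Reals Lra Lia Psatz Arith List Classical ClassicalEpsilon.
From Coquelicot Require Import Coquelicot.
Open Scope R_scope.

(** * Quantitative first-order jets *)

(** A lacunary series [sum a_k z^(m_k)] would show the same growth of the derivative, but it is
    bounded only when [sum a_k] converges, which [a_k = (k+1)^(-1/q)] violates for [q >= 1]. The
    recursion asks only for [sum a_k^2]. Its price is that [z^(m_(k+1))] comes multiplied by the
    function [R_k - a_k P_k], which could be small somewhere on the annulus, so one derivative alone
    gets no lower bound; two initial values and a final case distinction take the place of an
    explicit function. [L] is fixed last. In units of [a_k m_k], the frequencies below [m_k]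
    contribute [O(1/L)] to the derivative, because [a] decreases slowly. On the [k]-th annulus those
    above [m_k] contribute [O(1/L)] as well, because [(1-|z|) m_j >= L^(j-k)/4] there. Taking [L]
    large in terms of [B] and [kappa] thus lets one frequency dominate, with constants independent
    of [k]. *)

(* [c2] plays the role of a bound on the second derivative; stated with differences, the bounds pass
   to products and to pointwise limits without any mean value theorem in the complex plane. *)
Definition jet_bound (rho : R) (F F' : C -> C) (c0 c1 c2 : R) : Prop :=
  forall z w : C, Cmod z <= rho -> Cmod w <= rho ->
    Cmod (F z) <= c0 /\ Cmod (F' z) <= c1 /\
    Cmod (F w - F z) <= c1 * Cmod (w - z) /\
    Cmod (F' w - F' z) <= c2 * Cmod (w - z) /\
    Cmod (F w - F z - (w - z) * F' z) <= c2 * Cmod (w - z) ^ 2.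

Lemma Cmod_sub_sym (x y : C) : Cmod (x - y) = Cmod (y - x).
Proof. rewrite <- Cmod_opp. f_equal. ring. Qed.

Lemma Cmod_sub_le (x y : C) : Cmod (x - y) <= Cmod x + Cmod y.
Proof. rewrite <- (Cmod_opp y). apply Cmod_triangle. Qed.

Lemma Cmod_sub_ge (x y : C) : Cmod x - Cmod y <= Cmod (x - y).
Proof.
  generalize (Cmod_triangle (x - y) y).
  replace (x - y + y)%C with x by ring. lra.
Qed.

Lemma Cmod_mult_le (x y : C) (a b : R) :
  Cmod x <= a -> Cmod y <= b -> Cmod (x * y) <= a * b.
Proof.
  intros. rewrite Cmod_mult.
  apply Rmult_le_compat; auto using Cmod_ge_0.
Qed.

Lemma jet_mono rho rho' F F' c0 c1 c2 d0 d1 d2 :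
  rho' <= rho -> c0 <= d0 -> c1 <= d1 -> c2 <= d2 ->
  jet_bound rho F F' c0 c1 c2 -> jet_bound rho' F F' d0 d1 d2.
Proof.
  intros h h0 h1 h2 H z w hz hw.
  destruct (H z w) as (a0 & a1 & a2 & a3 & a4); try lra.
  assert (p := Cmod_ge_0 (w - z)).
  repeat split; nra.
Qed.

Lemma jet_const rho (c : C) : jet_bound rho (fun _ => c) (fun _ => RtoC 0) (Cmod c) 0 0.
Proof.
  intros z w _ _.
  replace (c - c - (w - z) * 0)%C with (RtoC 0) by ring.
  replace (c - c)%C with (RtoC 0) by ring.
  replace (0 - 0)%C with (RtoC 0) by ring.
  rewrite Cmod_0. repeat split; lra.
Qed.

Lemma jet_id rho : jet_bound rho (fun z => z) (fun _ => RtoC 1) rho 1 0.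
Proof.
  intros z w hz hw.
  replace (w - z - (w - z) * 1)%C with (RtoC 0) by ring.
  replace (1 - 1)%C with (RtoC 0) by ring.
  rewrite Cmod_0, Cmod_1. repeat split; lra.
Qed.

Lemma jet_add rho F F' G G' c0 c1 c2 d0 d1 d2 :
  jet_bound rho F F' c0 c1 c2 -> jet_bound rho G G' d0 d1 d2 ->
  jet_bound rho (fun z => F z + G z)%C (fun z => F' z + G' z)%C
    (c0 + d0) (c1 + d1) (c2 + d2).
Proof.
  intros HF HG z w hz hw.
  destruct (HF z w hz hw) as (a0 & a1 & a2 & a3 & a4).
  destruct (HG z w hz hw) as (b0 & b1 & b2 & b3 & b4).
  repeat split.
  - eapply Rle_trans; [apply Cmod_triangle | lra].
  - eapply Rle_trans; [apply Cmod_triangle | lra].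
  - replace (F w + G w - (F z + G z))%C with ((F w - F z) + (G w - G z))%C by ring.
    eapply Rle_trans; [apply Cmod_triangle | lra].
  - replace (F' w + G' w - (F' z + G' z))%C with ((F' w - F' z) + (G' w - G' z))%C by ring.
    eapply Rle_trans; [apply Cmod_triangle | lra].
  - replace (F w + G w - (F z + G z) - (w - z) * (F' z + G' z))%C
      with ((F w - F z - (w - z) * F' z) + (G w - G z - (w - z) * G' z))%C by ring.
    eapply Rle_trans; [apply Cmod_triangle | lra].
Qed.

(** The Leibniz rule for the three constants. Both cross products of the derivative increment
    contribute to [2 * c1 * d1]; the first-order remainder splits into the two remainders and one
    cross term. *)
Lemma jet_mul rho F F' G G' c0 c1 c2 d0 d1 d2 :
  jet_bound rho F F' c0 c1 c2 -> jet_bound rho G G' d0 d1 d2 ->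
  jet_bound rho (fun z => F z * G z)%C (fun z => F' z * G z + F z * G' z)%C
    (c0 * d0) (c1 * d0 + c0 * d1) (c2 * d0 + 2 * c1 * d1 + c0 * d2).
Proof.
  intros HF HG z w hz hw.
  destruct (HF z w hz hw) as (a0 & a1 & a2 & a3 & a4).
  destruct (HF w z hw hz) as (a0' & a1' & _ & _ & _).
  destruct (HG z w hz hw) as (b0 & b1 & b2 & b3 & b4).
  destruct (HG w z hw hz) as (b0' & b1' & _ & _ & _).
  set (h := Cmod (w - z)) in *.
  assert (ph : 0 <= h) by apply Cmod_ge_0.
  assert (p0 := Cmod_ge_0 (F z)). assert (p1 := Cmod_ge_0 (F' z)).
  assert (p2 := Cmod_ge_0 (G z)). assert (p3 := Cmod_ge_0 (G' z)).
  repeat split.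
  - now apply Cmod_mult_le.
  - eapply Rle_trans; [apply Cmod_triangle|].
    apply Rplus_le_compat; now apply Cmod_mult_le.
  - replace (F w * G w - F z * G z)%C
      with ((F w - F z) * G w + F z * (G w - G z))%C by ring.
    eapply Rle_trans; [apply Cmod_triangle|].
    generalize (Cmod_mult_le _ _ _ _ a2 b0') (Cmod_mult_le _ _ _ _ a0 b2). nra.
  - replace (F' w * G w + F w * G' w - (F' z * G z + F z * G' z))%C
      with ((F' w - F' z) * G w + F' z * (G w - G z)
            + ((F w - F z) * G' w + F z * (G' w - G' z)))%C by ring.
    eapply Rle_trans; [apply Cmod_triangle|].
    eapply Rle_trans; [apply Rplus_le_compat; apply Cmod_triangle|].
    generalize (Cmod_mult_le _ _ _ _ a3 b0') (Cmod_mult_le _ _ _ _ a1 b2)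
      (Cmod_mult_le _ _ _ _ a2 b1') (Cmod_mult_le _ _ _ _ a0 b3). nra.
  - replace (F w * G w - F z * G z - (w - z) * (F' z * G z + F z * G' z))%C
      with ((F w - F z - (w - z) * F' z) * G w + (w - z) * (F' z * (G w - G z))
            + F z * (G w - G z - (w - z) * G' z))%C by ring.
    eapply Rle_trans; [apply Cmod_triangle|].
    eapply Rle_trans; [apply Rplus_le_compat_r; apply Cmod_triangle|].
    assert (e : Cmod (w - z) <= h) by apply Rle_refl.
    generalize (Cmod_mult_le _ _ _ _ a4 b0')
      (Cmod_mult_le _ _ _ _ e (Cmod_mult_le _ _ _ _ a1 b2))
      (Cmod_mult_le _ _ _ _ a0 b4).
    assert (0 <= c1 * d1) by (apply Rmult_le_pos; lra).
    assert (0 <= h * h) by nra. nra.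
Qed.

Lemma jet_scal rho F F' c0 c1 c2 (a : R) : 0 <= a ->
  jet_bound rho F F' c0 c1 c2 ->
  jet_bound rho (fun z => a * F z)%C (fun z => a * F' z)%C (a * c0) (a * c1) (a * c2).
Proof.
  intros ha HF z w hz hw.
  destruct (HF z w hz hw) as (a0 & a1 & a2 & a3 & a4).
  replace (a * F w - a * F z - (w - z) * (a * F' z))%C
    with (a * (F w - F z - (w - z) * F' z))%C by ring.
  replace (a * F w - a * F z)%C with (a * (F w - F z))%C by ring.
  replace (a * F' w - a * F' z)%C with (a * (F' w - F' z))%C by ring.
  rewrite !Cmod_mult, Cmod_R, (Rabs_pos_eq a ha).
  repeat split; nra.
Qed.

Lemma jet_sub rho F F' G G' c0 c1 c2 d0 d1 d2 :
  jet_bound rho F F' c0 c1 c2 -> jet_bound rho G G' d0 d1 d2 ->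
  jet_bound rho (fun z => F z - G z)%C (fun z => F' z - G' z)%C
    (c0 + d0) (c1 + d1) (c2 + d2).
Proof.
  intros HF HG. apply (jet_add _ _ _ (fun z => - G z)%C (fun z => - G' z)%C _ _ _ _ _ _ HF).
  intros z w hz hw.
  destruct (HG z w hz hw) as (b0 & b1 & b2 & b3 & b4).
  replace (- G w - - G z - (w - z) * - G' z)%C
    with (- (G w - G z - (w - z) * G' z))%C by ring.
  replace (- G w - - G z)%C with (- (G w - G z))%C by ring.
  replace (- G' w - - G' z)%C with (- (G' w - G' z))%C by ring.
  rewrite !Cmod_opp. repeat split; auto.
Qed.

(** Induction through [z * z ^ m]. With [m ^ 2] instead of [m (m - 1)] the statement also holds for
    [m <= 1], where the truncated exponent [m - 2] is 0. *)
Lemma jet_pow rho m : 0 <= rho <= 1 ->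
  jet_bound rho (fun z => z ^ m)%C (fun z => INR m * z ^ (m - 1))%C
    (rho ^ m) (INR m * rho ^ (m - 1)) (INR m ^ 2 * rho ^ (m - 2)).
Proof.
  intros hr. induction m as [|m IH].
  - intros z w hz hw. generalize (jet_const rho (RtoC 1) z w hz hw).
    simpl. rewrite Cmod_1.
    replace (0 * 1)%C with (RtoC 0) by ring.
    intros (? & ? & ? & ? & ?). repeat split; lra.
  - assert (H := jet_mul _ _ _ _ _ _ _ _ _ _ _ (jet_id rho) IH).
    intros z w hz hw. specialize (H z w hz hw). cbv beta in H.
    assert (e : forall u : C, (1 * u ^ m + u * (INR m * u ^ (m - 1)))%C
                 = (INR (S m) * u ^ (S m - 1))%C).
    { intro u. rewrite S_INR. replace (S m - 1)%nat with m by lia.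
      rewrite RtoC_plus.
      destruct m as [|m]; [simpl; ring|].
      replace (S m - 1)%nat with m by lia. rewrite (Cpow_S u m). ring. }
    rewrite !e in H. destruct H as (a0 & a1 & a2 & a3 & a4).
    rewrite S_INR. replace (S m - 1)%nat with m by lia.
    assert (p := Cmod_ge_0 (w - z)).
    assert (q1 : 1 * rho ^ m + rho * (INR m * rho ^ (m - 1)) <= (INR m + 1) * rho ^ m).
    { destruct m as [|m]; [simpl; lra|].
      replace (S m - 1)%nat with m by lia. simpl pow. lra. }
    assert (q2 : 0 * rho ^ m + 2 * 1 * (INR m * rho ^ (m - 1)) +
                 rho * (INR m ^ 2 * rho ^ (m - 2))
                 <= (INR m + 1) ^ 2 * rho ^ (S m - 2)).
    { destruct m as [|[|m]]; [simpl; lra | simpl; lra |].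
      replace (S (S m) - 1)%nat with (S m) by lia.
      replace (S (S (S m)) - 2)%nat with (S m) by lia.
      replace (S (S m) - 2)%nat with m by lia.
      assert (0 <= rho ^ (S m)) by (apply pow_le; lra).
      simpl (rho ^ (S m)) in *. nra. }
    replace (S m - 1)%nat with m in * by lia. rewrite S_INR in *.
    repeat split; try assumption.
    + eapply Rle_trans; [exact a1 | exact q1].
    + eapply Rle_trans; [exact a2 | apply Rmult_le_compat_r; assumption].
    + eapply Rle_trans; [exact a3 | apply Rmult_le_compat_r; assumption].
    + eapply Rle_trans; [exact a4 | apply Rmult_le_compat_r; [apply pow_le|]; assumption].
Qed.

(** * Pointwise limits of complex sequences *)

Definition Cconv (u : nat -> C) (l : C) : Prop :=
  forall eps, 0 < eps -> exists N, forall n, (N <= n)%nat -> Cmod (u n - l) <= eps.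

Lemma Cconv_const (c : C) : Cconv (fun _ => c) c.
Proof.
  intros eps he. exists 0%nat. intros n _.
  replace (c - c)%C with (RtoC 0) by ring. rewrite Cmod_0. lra.
Qed.

Lemma Cconv_sub u v l m :
  Cconv u l -> Cconv v m -> Cconv (fun n => u n - v n)%C (l - m)%C.
Proof.
  intros Hu Hv eps he.
  destruct (Hu (eps / 2)) as [N1 H1]; [lra|].
  destruct (Hv (eps / 2)) as [N2 H2]; [lra|].
  exists (N1 + N2)%nat. intros n hn.
  specialize (H1 n ltac:(lia)). specialize (H2 n ltac:(lia)).
  replace (u n - v n - (l - m))%C with ((u n - l) - (v n - m))%C by ring.
  generalize (Cmod_sub_le (u n - l) (v n - m)). lra.
Qed.

Lemma Cconv_mul c u l : Cconv u l -> Cconv (fun n => c * u n)%C (c * l)%C.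
Proof.
  intros Hu eps he.
  assert (p := Cmod_ge_0 c).
  destruct (Hu (eps / (Cmod c + 1))) as [N H]; [apply Rdiv_lt_0_compat; lra|].
  exists N. intros n hn. specialize (H n hn).
  replace (c * u n - c * l)%C with (c * (u n - l))%C by ring.
  rewrite Cmod_mult.
  apply Rle_trans with ((Cmod c + 1) * (eps / (Cmod c + 1))).
  - apply Rmult_le_compat; try apply Cmod_ge_0; lra.
  - apply Req_le. field. lra.
Qed.

Lemma Cconv_le u l B N :
  Cconv u l -> (forall n, (N <= n)%nat -> Cmod (u n) <= B) -> Cmod l <= B.
Proof.
  intros Hu H. apply le_epsilon. intros eps he.
  destruct (Hu eps he) as [N1 H1].
  specialize (H1 (N + N1)%nat ltac:(lia)). specialize (H (N + N1)%nat ltac:(lia)).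
  generalize (Cmod_sub_ge l (u (N + N1)%nat)). rewrite Cmod_sub_sym. lra.
Qed.

(** Takes the place of the Weierstrass convergence theorem: since [c2] is uniform in [n], pointwise
    convergence of the functions and of their derivatives already makes [F'] the derivative of [F]
    inside the disc. *)
Lemma jet_lim rho F F' (Fn Fn' : nat -> C -> C) c0 c1 c2 :
  (forall n, jet_bound rho (Fn n) (Fn' n) c0 c1 c2) ->
  (forall z, Cmod z <= rho -> Cconv (fun n => Fn n z) (F z)) ->
  (forall z, Cmod z <= rho -> Cconv (fun n => Fn' n z) (F' z)) ->
  jet_bound rho F F' c0 c1 c2.
Proof.
  intros H HF HF' z w hz hw.
  assert (K := fun n => H n z w hz hw).
  repeat split; eapply (Cconv_le _ _ _ 0%nat);
    try (intros n _; destruct (K n) as (a0 & a1 & a2 & a3 & a4)).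
  - now apply HF. - exact a0.
  - now apply HF'. - exact a1.
  - apply Cconv_sub; now apply HF. - exact a2.
  - apply Cconv_sub; now apply HF'. - exact a3.
  - apply Cconv_sub; [apply Cconv_sub; now apply HF|]. apply Cconv_mul. now apply HF'.
  - exact a4.
Qed.

Lemma real_geometric_lim (u : nat -> R) (A : R) :
  (forall n, Rabs (u (S n) - u n) <= A * (/ 2) ^ n) -> ex_finite_lim_seq u.
Proof.
  intros H.
  assert (S1 : ex_series (fun n => A * (/ 2) ^ n)).
  { apply (ex_series_scal_l (K := R_AbsRing) (V := R_NormedModule) A (fun n => (/ 2) ^ n)). apply ex_series_geom.
    rewrite Rabs_pos_eq; lra. }
  assert (S2 : ex_series (fun n => u (S n) - u n)).
  { eapply (@ex_series_le R_AbsRing R_CompleteNormedModule); [|exact S1]. exact H. }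
  destruct S2 as [l hl].
  exists (l + u 0%nat).
  assert (L : is_lim_seq (sum_n (fun n => u (S n) - u n)) l) by exact hl.
  apply is_lim_seq_incr_1.
  apply is_lim_seq_ext with (fun n => sum_n (fun n => u (S n) - u n) n + u 0%nat).
  - intro n. induction n as [|n IH].
    + rewrite sum_O. lra.
    + rewrite sum_Sn. unfold plus; simpl. simpl in IH. lra.
  - apply (is_lim_seq_plus' _ (fun _ => u 0%nat)); [exact L | apply is_lim_seq_const].
Qed.

Lemma Cconv_geometric (u : nat -> C) (A : R) (N : nat) :
  (forall n, (N <= n)%nat -> Cmod (u (S n) - u n) <= A * (/ 2) ^ (n - N)) ->
  exists l, Cconv u l.
Proof.
  intros H.
  destruct (real_geometric_lim (fun n => fst (u (n + N)%nat)) A) as [x hx].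
  { intro n. specialize (H (n + N)%nat ltac:(lia)).
    replace (n + N - N)%nat with n in H by lia.
    eapply Rle_trans; [|exact H].
    eapply Rle_trans; [|apply Rmax_Cmod]. eapply Rle_trans; [|apply Rmax_l].
    apply Rle_refl. }
  destruct (real_geometric_lim (fun n => snd (u (n + N)%nat)) A) as [y hy].
  { intro n. specialize (H (n + N)%nat ltac:(lia)).
    replace (n + N - N)%nat with n in H by lia.
    eapply Rle_trans; [|exact H].
    eapply Rle_trans; [|apply Rmax_Cmod]. eapply Rle_trans; [|apply Rmax_r].
    apply Rle_refl. }
  exists (x, y). intros eps he.
  apply is_lim_seq_spec in hx. apply is_lim_seq_spec in hy.
  destruct (hx (mkposreal (eps / 2) ltac:(lra))) as [N1 H1].
  destruct (hy (mkposreal (eps / 2) ltac:(lra))) as [N2 H2].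
  exists (N1 + N2 + N)%nat. intros n hn.
  specialize (H1 (n - N)%nat ltac:(lia)). specialize (H2 (n - N)%nat ltac:(lia)).
  replace (n - N + N)%nat with n in * by lia. simpl in *.
  eapply Rle_trans; [apply Cmod_2Rmax|]. simpl.
  set (m := Rmax _ _).
  assert (0 <= m <= eps / 2).
  { unfold m. split; [eapply Rle_trans; [|apply Rmax_l]; apply Rabs_pos|].
    apply Rmax_lub; apply Rlt_le; assumption. }
  assert (sqrt 2 <= 2).
  { rewrite <- (sqrt_Rsqr 2) at 2 by lra. apply sqrt_le_1; unfold Rsqr; lra. }
  assert (0 <= sqrt 2) by apply sqrt_pos. nra.
Qed.

(** * The recursion *)

(** The matrix with rows [(1, a)] and [(-a, 1)] is [sqrt (1 + a^2)] times a rotation, so it scales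
    the Euclidean norm exactly. *)
Lemma energy_step (a : R) (P Q : C) :
  Cmod (P + a * Q) ^ 2 + Cmod (Q - a * P) ^ 2
  = (1 + a ^ 2) * (Cmod P ^ 2 + Cmod Q ^ 2).
Proof.
  rewrite !Cmod2_alt. destruct P as [p1 p2], Q as [q1 q2].
  unfold Re, Im. simpl. ring.
Qed.

Lemma exp_INR_mult (n : nat) (x : R) : exp (INR n * x) = exp x ^ n.
Proof.
  induction n as [|n IH]; [simpl; rewrite Rmult_0_l; apply exp_0|].
  rewrite S_INR, Rmult_plus_distr_r, exp_plus, IH. simpl. ring_simplify (1 * x). ring.
Qed.

(** With [x = m d], the power is at most [exp (- x)], and [exp x = exp (x / 3) ^ 3 >= (x / 3) ^ 3].
    The third power pays for the two factors [m] of a second derivative and leaves one for geometric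
    decay. *)
Lemma pow_decay (d : R) (m : nat) :
  0 <= d <= 1 -> (1 - d) ^ m * (INR m * d) ^ 3 <= 27.
Proof.
  intros hd. assert (hm := pos_INR m).
  assert (h1 : (1 - d) ^ m <= exp (- (INR m * d))).
  { replace (- (INR m * d)) with (INR m * - d) by ring.
    rewrite exp_INR_mult. apply pow_incr. split; [lra|].
    generalize (exp_ineq1_le (- d)). lra. }
  set (x := INR m * d) in *.
  assert (hx : 0 <= x) by (apply Rmult_le_pos; lra).
  assert (h2 : (x / 3) ^ 3 <= exp x).
  { replace x with (INR 3 * (x / 3)) at 2 by (simpl; field).
    rewrite exp_INR_mult. apply pow_incr. generalize (exp_ineq1_le (x / 3)). lra. }
  assert (h3 : exp (- x) * exp x = 1).
  { rewrite <- exp_plus. replace (- x + x) with 0 by ring. apply exp_0. }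
  assert (h4 := exp_pos (- x)).
  apply Rle_trans with (exp (- x) * x ^ 3).
  - apply Rmult_le_compat_r; [apply pow_le; lra | exact h1].
  - replace (x ^ 3) with (27 * (x / 3) ^ 3) by field.
    apply Rle_trans with (27 * (exp (- x) * exp x)); [|lra].
    nra.
Qed.

Section RudinShapiro.

Context (L : nat) (a : nat -> R) (B kappa : R) (E : nat -> R).

Definition freq (k : nat) : nat := (L ^ k)%nat.

(* [rs s k z] is the pair [(P_k z, R_k z)] started at [s]. *)
Fixpoint rs (s : C * C) (k : nat) (z : C) : C * C :=
  match k with
  | O => s
  | S k => ((fst (rs s k z) + a k * snd (rs s k z))%C,
            (z ^ freq (S k) * (snd (rs s k z) - a k * fst (rs s k z)))%C)
  end.

Fixpoint drs (s : C * C) (k : nat) (z : C) : C * C :=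
  match k with
  | O => (RtoC 0, RtoC 0)
  | S k => ((fst (drs s k z) + a k * snd (drs s k z))%C,
            (INR (freq (S k)) * z ^ (freq (S k) - 1) * (snd (rs s k z) - a k * fst (rs s k z))
             + z ^ freq (S k) * (snd (drs s k z) - a k * fst (drs s k z)))%C)
  end.

Definition mu (k : nat) : R := INR (freq k).
(** Outer radius of the [k]-th annulus. On [|z| <= rad k] the limit functions have jets of scale
    [mu k]. *)
Definition rad (k : nat) : R := 1 - / (4 * mu k).

Hypothesis hL16 : 16 <= INR L.
Hypothesis hLk : 2 * kappa <= INR L.
Hypothesis hk1 : 1 <= kappa.
Hypothesis hB : 1 <= B.
Hypothesis ha : forall k, 0 < a k <= 1.
Hypothesis ha_dec : forall k, a (S k) <= a k.
Hypothesis ha_slow : forall k, a k <= kappa * a (S k).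
Hypothesis hE0 : E 0 = 1.
Hypothesis hES : forall k, E (S k) = (1 + a k ^ 2) * E k.
Hypothesis hEB : forall k, E k <= B ^ 2.

Lemma mu_0 : mu 0 = 1.
Proof. reflexivity. Qed.

Lemma mu_S k : mu (S k) = INR L * mu k.
Proof. unfold mu, freq. simpl. now rewrite mult_INR. Qed.

Lemma mu_ge_1 k : 1 <= mu k.
Proof. clear hLk. induction k as [|k IH]; [rewrite mu_0; lra | rewrite mu_S; nra]. Qed.

Lemma mu_add k i : mu (k + i) = mu k * INR L ^ i.
Proof.
  induction i as [|i IH]; [rewrite Nat.add_0_r; simpl; ring|].
  rewrite Nat.add_succ_r, mu_S, IH. simpl. ring.
Qed.

Lemma rad_range k : 3 / 4 <= rad k < 1.
Proof.
  unfold rad. assert (h := mu_ge_1 k).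
  assert (0 < / (4 * mu k)) by (apply Rinv_0_lt_compat; lra).
  assert (/ (4 * mu k) <= / 4) by (apply Rinv_le_contravar; lra). lra.
Qed.

Lemma a_anti k i : a (k + i) <= a k.
Proof.
  induction i as [|i IH]; [rewrite Nat.add_0_r; lra|].
  rewrite Nat.add_succ_r. eapply Rle_trans; [apply ha_dec | exact IH].
Qed.

(* Cubic decay of [rho ^ m] absorbs up to two factors [m], hence covers second derivatives. *)
Lemma freq_decay k i e : (e <= 2)%nat ->
  mu (k + S i) ^ e * rad k ^ (freq (k + S i) - e)
  <= 3456 * mu k ^ e * (/ INR L * (/ 2) ^ i).
Proof.
  intros he. assert (hk := mu_ge_1 k). assert (hr := rad_range k).
  set (m := freq (k + S i)).
  assert (hm : mu (k + S i) = mu k * INR L ^ S i) by apply mu_add.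
  assert (hmm : INR m = mu (k + S i)) by reflexivity.
  set (l := INR L ^ S i) in *.
  assert (hl : INR L * 2 ^ i <= l).
  { unfold l. simpl. apply Rmult_le_compat_l; [lra|].
    apply pow_incr. lra. }
  assert (h2i : 1 <= 2 ^ i) by (apply pow_R1_Rle; lra).
  assert (hl16 : 16 <= l) by nra.
  assert (hm2 : (2 <= m)%nat).
  { apply INR_le. rewrite hmm, hm. simpl. nra. }
  assert (D := pow_decay (/ (4 * mu k)) m).
  fold (rad k) in D. rewrite hmm, hm in D.
  replace (mu k * l * / (4 * mu k)) with (l / 4) in D by (field; lra).
  assert (hinv : 0 <= / (4 * mu k) <= 1).
  { unfold rad in hr. lra. }
  specialize (D hinv).
  (* [rad k >= 3/4] and [e <= 2], and [2 * (3/4)^2 >= 1]. *)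
  assert (Q : rad k ^ (m - e) <= 2 * rad k ^ m).
  { replace (rad k ^ m) with (rad k ^ (m - e) * rad k ^ e)
      by (rewrite <- pow_add; f_equal; lia).
    assert (0 <= rad k ^ (m - e)) by (apply pow_le; lra).
    assert (1 <= 2 * rad k ^ e).
    { destruct e as [|[|[|e]]]; simpl; try lra; try nra. lia. }
    nra. }
  assert (hp : 0 <= rad k ^ m) by (apply pow_le; lra).
  (* [1728 = 27 * 4^3], because [m d = l / 4]; the factor 2 of [Q] then gives 3456. *)
  assert (hl3 : rad k ^ m * l ^ 3 <= 1728).
  { replace ((l / 4) ^ 3) with (l ^ 3 / 64) in D by field. lra. }
  assert (hle : l ^ e * l <= l ^ 3).
  { replace (l ^ e * l) with (l ^ S e) by (simpl; ring). apply Rle_pow; [lra | lia]. }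
  assert (hle0 : 0 <= l ^ e) by (apply pow_le; lra).
  assert (T : l ^ e * rad k ^ (m - e) * l <= 3456).
  { apply Rle_trans with (2 * (rad k ^ m * (l ^ e * l))).
    - assert (0 <= l ^ e * l) by (apply Rmult_le_pos; lra). nra.
    - assert (rad k ^ m * (l ^ e * l) <= rad k ^ m * l ^ 3)
        by (apply Rmult_le_compat_l; assumption). lra. }
  assert (T2 : l ^ e * rad k ^ (m - e) <= 3456 * / l).
  { apply Rmult_le_reg_r with l; [lra|].
    replace (3456 * / l * l) with 3456 by (field; lra). exact T. }
  assert (T3 : / l <= / INR L * (/ 2) ^ i).
  { rewrite pow_inv, <- Rinv_mult. apply Rinv_le_contravar; [|exact hl]. nra. }
  rewrite hm, Rpow_mult_distr.
  assert (0 <= mu k ^ e) by (apply pow_le; lra).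
  nra.
Qed.

(** * Jet bounds and limit functions for one initial pair *)

Section OneStart.

Context (s : C * C).
Hypothesis hs : Cmod (fst s) ^ 2 + Cmod (snd s) ^ 2 <= 1.

Let P k z := fst (rs s k z).
Let Q k z := snd (rs s k z).
Let S' k z := (snd (rs s k z) - a k * fst (rs s k z))%C.
Let P' k z := fst (drs s k z).
Let Q' k z := snd (drs s k z).
Let dS k z := (snd (drs s k z) - a k * fst (drs s k z))%C.

Lemma rs_energy k z : Cmod z <= 1 -> Cmod (P k z) ^ 2 + Cmod (Q k z) ^ 2 <= E k.
Proof.
  intros hz. induction k as [|k IH].
  - unfold P, Q; simpl (rs _ _ _). lra.
  - rewrite hES.
    assert (H := energy_step (a k) (P k z) (Q k z)).
    change (P (S k) z) with (P k z + a k * Q k z)%C.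
    change (Q (S k) z) with (z ^ freq (S k) * (Q k z - a k * P k z))%C.
    rewrite Cmod_mult, Cmod_pow, Rpow_mult_distr.
    assert (hp : (Cmod z ^ freq (S k)) ^ 2 <= 1).
    { rewrite <- pow_mult. rewrite <- (pow1 (freq (S k) * 2)). apply pow_incr.
      split; [apply Cmod_ge_0 | exact hz]. }
    assert (0 <= Cmod (Q k z - a k * P k z) ^ 2) by apply pow2_ge_0.
    assert (0 <= a k ^ 2) by apply pow2_ge_0.
    nra.
Qed.

Lemma Cmod_sq_le x y : 0 <= y -> Cmod x ^ 2 <= y ^ 2 -> Cmod x <= y.
Proof. intros hy h. apply Rnot_lt_le. intro k. assert (p := Cmod_ge_0 x). nra. Qed.

Lemma rs_fst_le k z : Cmod z <= 1 -> Cmod (P k z) <= B.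
Proof.
  intros hz. apply Cmod_sq_le; [lra|].
  generalize (rs_energy k z hz) (hEB k) (pow2_ge_0 (Cmod (Q k z))). lra.
Qed.

Lemma rs_snd_le k z : Cmod z <= 1 -> Cmod (Q k z) <= B.
Proof.
  intros hz. apply Cmod_sq_le; [lra|].
  generalize (rs_energy k z hz) (hEB k) (pow2_ge_0 (Cmod (P k z))). lra.
Qed.

(** [S' k] is [Q (S k)] before the power of [z] multiplies it, so the energy at step [k + 1] bounds
    it by [B] itself and not by [B + a k * B]. *)
Lemma rs_diff_le k z : Cmod z <= 1 -> Cmod (S' k z) <= B.
Proof.
  intros hz. apply Cmod_sq_le; [lra|].
  assert (H := energy_step (a k) (P k z) (Q k z)).
  assert (h1 := rs_energy k z hz). assert (h2 := hEB (S k)). rewrite hES in h2.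
  assert (0 <= a k ^ 2) by apply pow2_ge_0.
  assert (h3 := pow2_ge_0 (Cmod (P k z + a k * Q k z))).
  unfold S'. fold (P k z) (Q k z). nra.
Qed.

(** Sums of jets add up their sup bounds, which would grow with [k]; after each step the energy
    estimate resets [c0] to [B]. *)
Lemma jet_c0 rho F F' c0 c0' c1 c2 :
  (forall z, Cmod z <= rho -> Cmod (F z) <= c0') ->
  jet_bound rho F F' c0 c1 c2 -> jet_bound rho F F' c0' c1 c2.
Proof.
  intros h H z w hz hw. destruct (H z w hz hw) as (? & ? & ? & ? & ?).
  repeat split; auto.
Qed.

(** The gain [1 / L] for [P k]: its last summand has derivative of order [a (k-1) * mu (k-1) <=
    kappa * a k * mu k / L]. The constant 8 is twice the 4 of [Q], half for this summand and half
    for all earlier ones. *)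
Definition jets_ok k :=
  jet_bound 1 (P k) (P' k) B (8 * B * kappa / INR L * a k * mu k)
    (16 * B * kappa / INR L * a k * mu k ^ 2)
  /\ jet_bound 1 (Q k) (Q' k) B (4 * B * mu k) (8 * B * mu k ^ 2).

(** Here [2 * kappa <= L] enters: the growth of the frequencies beats the decay of [a], which closes
    the induction for [P]. *)
Lemma small_ratio : 8 * B * kappa / INR L <= 4 * B /\ 0 <= 8 * B * kappa / INR L.
Proof.
  split.
  - apply Rmult_le_reg_r with (INR L); [lra|].
    replace (8 * B * kappa / INR L * INR L) with (8 * B * kappa) by (field; lra). nra.
  - apply Rle_mult_inv_pos; [|lra]. nra.
Qed.

Lemma jet_diff k : jets_ok k ->
  jet_bound 1 (S' k) (dS k) B (8 * B * mu k) (16 * B * mu k ^ 2).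
Proof.
  intros [HP HQ]. unfold S', dS.
  assert (h := ha k). assert (hm := mu_ge_1 k).
  assert (J := jet_sub _ _ _ _ _ _ _ _ _ _ _ HQ (jet_scal _ _ _ _ _ _ (a k) ltac:(lra) HP)).
  destruct small_ratio as [hr hr0].
  set (x := 8 * B * kappa / INR L) in *.
  replace (16 * B * kappa / INR L) with (2 * x) in J by (unfold x; field; lra).
  apply jet_c0 with (B + a k * B); [apply rs_diff_le|].
  revert J. apply jet_mono; try lra.
  - assert (a k * a k <= 1) by nra. assert (0 <= a k * a k) by nra.
    assert (a k * a k * x <= 4 * B) by nra. nra.
  - assert (a k * a k <= 1) by nra. assert (0 <= a k * a k) by nra.
    assert (a k * a k * x <= 4 * B) by nra.
    assert (0 <= mu k ^ 2) by apply pow2_ge_0. nra.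
Qed.

(** Serves twice: at [rho = 1] it closes the induction on [jets_ok], and at [rho = rad k] its powers
    of [rho] make the later terms decay. As [mu (S k) >= 16 * mu k], derivatives falling on [S' k]
    are of lower order than those falling on the power of [z], so 4 and 8 reproduce themselves. *)
Lemma jet_snd_S k rho : 0 <= rho <= 1 -> jets_ok k ->
  jet_bound rho (Q (S k)) (Q' (S k)) (B * rho ^ freq (S k))
    (4 * B * (mu (S k) * rho ^ (freq (S k) - 1)))
    (8 * B * (mu (S k) ^ 2 * rho ^ (freq (S k) - 2))).
Proof.
  intros hr H.
  assert (J1 : jet_bound rho (S' k) (dS k) B (8 * B * mu k) (16 * B * mu k ^ 2)).
  { eapply jet_mono; [| | | | apply (jet_diff k H)]; lra. }
  assert (J := jet_mul _ _ _ _ _ _ _ _ _ _ _ (jet_pow rho (freq (S k)) hr) J1).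
  fold (mu (S k)) in J.
  assert (hm := mu_ge_1 k).
  assert (hm2 : (2 <= freq (S k))%nat).
  { apply INR_le. fold (mu (S k)). rewrite mu_S. simpl. nra. }
  assert (hmu : 16 * mu k <= mu (S k)) by (rewrite mu_S; nra).
  set (m := mu (S k)) in *. set (n := freq (S k)) in *.
  assert (e1 : rho ^ n = rho * rho ^ (n - 1)).
  { replace n with (S (n - 1)) at 1 by lia. reflexivity. }
  assert (e2 : rho ^ (n - 1) = rho * rho ^ (n - 2)).
  { replace (n - 1)%nat with (S (n - 2)) by lia. reflexivity. }
  set (r2 := rho ^ (n - 2)) in *. set (r1 := rho ^ (n - 1)) in *.
  assert (0 <= r2) by (apply pow_le; lra).
  assert (0 <= r1) by (apply pow_le; lra).
  assert (r1 <= r2) by nra.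
  assert (rho ^ n <= r1) by (rewrite e1; nra).
  assert (rho ^ n <= r2) by lra.
  assert (0 <= rho ^ n) by (apply pow_le; lra).
  eapply jet_mono; [| | | | exact J]; try lra.
  - assert (rho ^ n * (8 * B * mu k) <= r1 * (B * m)).
    { apply Rmult_le_compat; try nra. }
    assert (0 <= r1 * (B * m)) by (repeat apply Rmult_le_pos; lra).
    lra.
  - assert (rho ^ n * (16 * B * mu k ^ 2) <= r2 * (B * m ^ 2)).
    { assert (0 <= mu k ^ 2) by apply pow2_ge_0.
      assert (16 * mu k ^ 2 <= m ^ 2) by nra.
      apply Rmult_le_compat; try nra. }
    assert (m * r1 * (8 * B * mu k) <= m * r2 * (B * m)).
    { apply Rmult_le_compat; try nra. }
    assert (0 <= r2 * (B * m ^ 2)) by (repeat apply Rmult_le_pos; try lra; apply pow2_ge_0).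
    assert (m * r2 * (B * m) = r2 * (B * m ^ 2)) by ring.
    lra.
Qed.

Lemma jets_ok_all k : jets_ok k.
Proof.
  induction k as [|k IH].
  - destruct small_ratio as [hr hr0]. assert (h := ha 0).
    split.
    + eapply jet_c0; [intros z hz; apply rs_fst_le; lra|].
      eapply jet_mono; [| | | | apply (jet_const 1 (fst s))]; try lra; try apply Rle_refl.
      * rewrite mu_0. nra.
      * rewrite mu_0. replace (16 * B * kappa / INR L) with (2 * (8 * B * kappa / INR L)) by (field; lra). nra.
    + eapply jet_c0; [intros z hz; apply rs_snd_le; lra|].
      eapply jet_mono; [| | | | apply (jet_const 1 (snd s))]; try lra; try apply Rle_refl;
      rewrite mu_0; nra.
  - assert (JS := jet_snd_S k 1 ltac:(lra) IH). rewrite !pow1 in JS.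
    split.
    + destruct IH as [HP HQ]. assert (h := ha k).
      assert (J := jet_add _ _ _ _ _ _ _ _ _ _ _ HP (jet_scal _ _ _ _ _ _ (a k) ltac:(lra) HQ)).
      eapply jet_c0; [intros z hz; apply rs_fst_le; lra|].
      destruct small_ratio as [hr hr0]. assert (hm := mu_ge_1 k).
      assert (hs1 := ha_slow k). rewrite mu_S.
      set (x := 8 * B * kappa / INR L) in *.
      assert (0 < a k * mu k) by nra.
      eapply jet_mono; [| | | | exact J]; try lra; try apply Rle_refl.
      * replace (x * a (S k) * (INR L * mu k))
          with (8 * B * (kappa * a (S k)) * mu k) by (unfold x; field; lra).
        assert (x * a k * mu k <= 4 * B * a k * mu k).
        { assert (0 <= (4 * B - x) * (a k * mu k)) by (apply Rmult_le_pos; lra). lra. }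
        assert (8 * B * a k * mu k <= 8 * B * (kappa * a (S k)) * mu k).
        { apply Rmult_le_compat_r; [lra|]. apply Rmult_le_compat_l; lra. }
        lra.
      * replace (16 * B * kappa / INR L * a (S k) * (INR L * mu k) ^ 2)
          with (16 * B * (kappa * a (S k)) * mu k ^ 2 * INR L) by (field; lra).
        replace (16 * B * kappa / INR L) with (2 * x) by (unfold x; field; lra).
        assert (hq : 0 < mu k ^ 2) by nra.
        assert (0 < a k * mu k ^ 2) by nra.
        assert (2 * x * a k * mu k ^ 2 <= 8 * B * a k * mu k ^ 2).
        { assert (0 <= (4 * B - x) * (a k * mu k ^ 2)) by (apply Rmult_le_pos; lra). lra. }
        assert (16 * B * a k * mu k ^ 2 <= 16 * B * (kappa * a (S k)) * mu k ^ 2).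
        { apply Rmult_le_compat_r; [lra|]. apply Rmult_le_compat_l; lra. }
        assert (0 <= 16 * B * a k * mu k ^ 2) by nra.
        nra.
    + eapply jet_mono; [| | | | exact JS]; lra.
Qed.

(** [27648 = 8 * 3456]: the largest constant of [jet_snd_S] times that of [freq_decay]. *)
Let D := 27648 * B.

Lemma jet_snd_tail k i :
  jet_bound (rad k) (Q (k + S i)) (Q' (k + S i)) (D / INR L * (/ 2) ^ i)
    (D / INR L * (/ 2) ^ i * mu k) (D / INR L * (/ 2) ^ i * mu k ^ 2).
Proof.
  assert (hr := rad_range k).
  assert (J := jet_snd_S (k + i) (rad k) ltac:(lra) (jets_ok_all _)).
  rewrite <- Nat.add_succ_r in J.
  assert (d0 := freq_decay k i 0 ltac:(lia)).
  assert (d1 := freq_decay k i 1 ltac:(lia)).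
  assert (d2 := freq_decay k i 2 ltac:(lia)).
  rewrite Nat.sub_0_r in d0. simpl (_ ^ 0) in d0. rewrite pow_1 in d1.
  rewrite pow_1 in d1.
  assert (h2 : 0 <= (/ 2) ^ i) by (apply pow_le; lra).
  assert (hL : 0 <= / INR L) by (left; apply Rinv_0_lt_compat; lra).
  assert (hm := mu_ge_1 k).
  unfold D, Rdiv.
  set (y := / INR L * (/ 2) ^ i) in *.
  assert (hy : 0 <= y) by (apply Rmult_le_pos; assumption).
  assert (0 <= mu k ^ 2) by apply pow2_ge_0.
  replace (27648 * B * / INR L * (/ 2) ^ i) with (27648 * B * y) by (unfold y; ring).
  eapply jet_mono; [| | | | exact J]; try lra.
  - nra.
  - assert (0 <= y * mu k) by nra. nra.
  - assert (0 <= y * mu k ^ 2) by nra. nra.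
Qed.

(** The difference starts at [k + 1], so that [a k * Q k] is left out and everything else is small
    by [1 / L]. The factor [1 - (/ 2) ^ i] is the partial geometric sum, which makes the bound
    inductive. *)
Lemma jet_tail k i :
  jet_bound (rad k) (fun z => P (k + S i) z - P (k + 1) z)%C
    (fun z => P' (k + S i) z - P' (k + 1) z)%C
    (2 * D / INR L * a k * (1 - (/ 2) ^ i))
    (2 * D / INR L * a k * (1 - (/ 2) ^ i) * mu k)
    (2 * D / INR L * a k * (1 - (/ 2) ^ i) * mu k ^ 2).
Proof.
  assert (hL : 0 <= / INR L) by (left; apply Rinv_0_lt_compat; lra).
  assert (hm := mu_ge_1 k).
  induction i as [|i IH].
  - intros z w _ _. replace (k + 1)%nat with (k + 1)%nat by lia.
    simpl (_ ^ 0).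
    assert (e : forall x : C, (x - x)%C = RtoC 0) by (intro; ring).
    rewrite !e. replace (0 - (w - z) * 0)%C with (RtoC 0) by ring. rewrite Cmod_0.
    repeat split; lra.
  - assert (h := ha (k + S i)).
    assert (J := jet_add _ _ _ _ _ _ _ _ _ _ _ IH
      (jet_scal _ _ _ _ _ _ (a (k + S i)) ltac:(lra) (jet_snd_tail k i))).
    assert (hd := a_anti k (S i)).
    assert (h2 : 0 <= (/ 2) ^ i) by (apply pow_le; lra).
    assert (hy : 0 <= D / INR L * (/ 2) ^ i).
    { unfold D, Rdiv. repeat apply Rmult_le_pos; lra. }
    assert (K : a (k + S i) * (D / INR L * (/ 2) ^ i) <= a k * (D / INR L * (/ 2) ^ i))
      by (apply Rmult_le_compat_r; lra).
    assert (K2 : 2 * D / INR L * a k * (1 - (/ 2) ^ S i)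
      = 2 * D / INR L * a k * (1 - (/ 2) ^ i) + a k * (D / INR L * (/ 2) ^ i)).
    { simpl. field. lra. }
    assert (0 <= mu k ^ 2) by apply pow2_ge_0.
    assert (J2 := fun d0 d1 d2 h0 h1 h2 =>
       jet_mono _ _ _ _ _ _ _ d0 d1 d2 (Rle_refl (rad k)) h0 h1 h2 J).
    specialize (J2 (2 * D / INR L * a k * (1 - (/ 2) ^ S i))
       (2 * D / INR L * a k * (1 - (/ 2) ^ S i) * mu k)
       (2 * D / INR L * a k * (1 - (/ 2) ^ S i) * mu k ^ 2)
       ltac:(lra) ltac:(rewrite K2; nra) ltac:(rewrite K2; nra)).
    intros z w hz hw. specialize (J2 z w hz hw). cbv beta in J2.
    rewrite !(Nat.add_succ_r k (S i)).
    change (P (S (k + S i)))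
      with (fun z => P (k + S i) z + a (k + S i)%nat * Q (k + S i) z)%C.
    change (P' (S (k + S i)))
      with (fun z => P' (k + S i) z + a (k + S i)%nat * Q' (k + S i) z)%C.
    cbv beta.
    assert (e : forall x y t : C, (x + y - t)%C = (x - t + y)%C) by (intros; ring).
    rewrite !(e (P _ _)), !(e (P' _ _)). exact J2.
Qed.

Lemma D_ratio : 0 <= 2 * D / INR L <= 3456 * B.
Proof.
  unfold D. split.
  - apply Rle_mult_inv_pos; lra.
  - apply Rmult_le_reg_r with (INR L); [lra|].
    replace (2 * (27648 * B) / INR L * INR L) with (55296 * B) by (field; lra). nra.
Qed.

(** Split into [P k], the term [a k * Q k] and the tail; 4000 rounds up [4 + 4 + 3456] for the first
    derivative and [8 + 8 + 3456] for the second. *)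
Lemma jet_fst_rad k i :
  jet_bound (rad k) (P (k + S i)) (P' (k + S i)) B
    (4000 * B * a k * mu k) (4000 * B * a k * mu k ^ 2).
Proof.
  destruct (jets_ok_all k) as [HP HQ]. assert (h := ha k).
  assert (hr := rad_range k). assert (hm := mu_ge_1 k).
  assert (J1 := jet_add _ _ _ _ _ _ _ _ _ _ _ HP (jet_scal _ _ _ _ _ _ (a k) ltac:(lra) HQ)).
  assert (J2 := jet_mono 1 (rad k) _ _ _ _ _ _ _ _ ltac:(lra) (Rle_refl _) (Rle_refl _) (Rle_refl _) J1).
  assert (J := jet_add _ _ _ _ _ _ _ _ _ _ _ J2 (jet_tail k i)).
  eapply jet_c0; [intros z hz; apply rs_fst_le; lra|].
  destruct small_ratio as [hr1 hr0]. destruct D_ratio as [hD0 hD1].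
  set (x := 8 * B * kappa / INR L) in *.
  replace (16 * B * kappa / INR L) with (2 * x) in J by (unfold x; field; lra).
  set (y := 2 * D / INR L) in *.
  set (t := 1 - (/ 2) ^ i) in *.
  assert (ht : 0 <= t <= 1).
  { unfold t. assert (0 <= (/ 2) ^ i) by (apply pow_le; lra).
    assert ((/ 2) ^ i <= 1) by (rewrite <- (pow1 i); apply pow_incr; lra). lra. }
  assert (hyt : 0 <= y * t <= 3456 * B) by nra.
  assert (J3 : jet_bound (rad k) (fun z => P k z + a k * Q k z + (P (k + S i) z - P (k + 1) z))%C
     (fun z => P' k z + a k * Q' k z + (P' (k + S i) z - P' (k + 1) z))%C
     (B + a k * B + y * a k * t) (4000 * B * a k * mu k) (4000 * B * a k * mu k ^ 2)).
  { eapply jet_mono; [| | | | exact J]; try lra.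
    - assert (0 < a k * mu k) by nra.
      replace (x * a k * mu k + a k * (4 * B * mu k) + y * a k * t * mu k)
        with ((x + 4 * B + y * t) * (a k * mu k)) by ring.
      replace (4000 * B * a k * mu k) with (4000 * B * (a k * mu k)) by ring.
      apply Rmult_le_compat_r; lra.
    - assert (0 < mu k ^ 2) by nra. assert (0 < a k * mu k ^ 2) by nra.
      replace (2 * x * a k * mu k ^ 2 + a k * (8 * B * mu k ^ 2) + y * a k * t * mu k ^ 2)
        with ((2 * x + 8 * B + y * t) * (a k * mu k ^ 2)) by ring.
      replace (4000 * B * a k * mu k ^ 2) with (4000 * B * (a k * mu k ^ 2)) by ring.
      apply Rmult_le_compat_r; lra. }
  intros z w hz hw. specialize (J3 z w hz hw). cbv beta in J3.
  replace (k + 1)%nat with (S k) in J3 by lia.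
  change (P (S k)) with (fun z => P k z + a k * Q k z)%C in J3.
  change (P' (S k)) with (fun z => P' k z + a k * Q' k z)%C in J3.
  cbv beta in J3.
  assert (e : forall x y : C, (x + (y - x))%C = y) by (intros; ring).
  rewrite !e in J3. exact J3.
Qed.

Lemma rs_fst_conv k z : Cmod z <= rad k -> exists l, Cconv (fun n => P n z) l.
Proof.
  intros hz. apply Cconv_geometric with (D / INR L) (S k).
  intros n hn. replace n with (k + S (n - S k))%nat at 1 2 by lia.
  set (i := (n - S k)%nat).
  change (P (S (k + S i)) z) with (P (k + S i) z + a (k + S i)%nat * Q (k + S i) z)%C.
  replace (P (k + S i) z + a (k + S i)%nat * Q (k + S i) z - P (k + S i) z)%C
    with (a (k + S i)%nat * Q (k + S i) z)%C by ring.
  destruct (jet_snd_tail k i z z hz hz) as (b & _).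
  assert (h := ha (k + S i)).
  rewrite Cmod_mult, Cmod_R, Rabs_pos_eq by lra.
  assert (p := Cmod_ge_0 (Q (k + S i) z)). nra.
Qed.

Lemma drs_fst_conv k z : Cmod z <= rad k -> exists l, Cconv (fun n => P' n z) l.
Proof.
  intros hz. apply Cconv_geometric with (D / INR L * mu k) (S k).
  intros n hn. replace n with (k + S (n - S k))%nat at 1 2 by lia.
  set (i := (n - S k)%nat).
  change (P' (S (k + S i)) z) with (P' (k + S i) z + a (k + S i)%nat * Q' (k + S i) z)%C.
  replace (P' (k + S i) z + a (k + S i)%nat * Q' (k + S i) z - P' (k + S i) z)%C
    with (a (k + S i)%nat * Q' (k + S i) z)%C by ring.
  destruct (jet_snd_tail k i z z hz hz) as (_ & b & _).
  assert (h := ha (k + S i)).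
  rewrite Cmod_mult, Cmod_R, Rabs_pos_eq by lra.
  assert (p := Cmod_ge_0 (Q' (k + S i) z)). nra.
Qed.

(** [epsilon] makes the limit functions total on [C]; only their values in the open disc, where the
    sequences converge, are used. *)
Definition Clim (u : nat -> C) : C := epsilon (inhabits (RtoC 0)) (Cconv u).

Lemma Clim_spec u : (exists l, Cconv u l) -> Cconv u (Clim u).
Proof. apply epsilon_spec. Qed.

Definition rs_lim (z : C) : C := Clim (fun n => P n z).
Definition drs_lim (z : C) : C := Clim (fun n => P' n z).

Lemma Cconv_shift u l (g : nat -> nat) :
  (forall n, (n <= g n)%nat) -> Cconv u l -> Cconv (fun n => u (g n)) l.
Proof.
  intros hg H eps he. destruct (H eps he) as [N HN].
  exists N. intros n hn. apply HN. specialize (hg n). lia.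
Qed.

Lemma jet_rs_lim k : jet_bound (rad k) rs_lim drs_lim B
    (4000 * B * a k * mu k) (4000 * B * a k * mu k ^ 2).
Proof.
  apply (jet_lim _ _ _ (fun i => P (k + S i)) (fun i => P' (k + S i))).
  - intro i. apply jet_fst_rad.
  - intros z hz. apply (Cconv_shift (fun n => P n z) _ (fun i => (k + S i)%nat)); [intro; lia|].
    apply Clim_spec. eapply rs_fst_conv; eauto.
  - intros z hz. apply (Cconv_shift (fun n => P' n z) _ (fun i => (k + S i)%nat)); [intro; lia|].
    apply Clim_spec. eapply drs_fst_conv; eauto.
Qed.

(** The main term is the derivative of [z ^ freq (S k)] times [S' k]. The three errors come, in
    order, from [P' (S k)], that is from lower frequencies, from the derivative falling on [S' k],
    and from the tail beyond [S k]. *)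
Lemma drs_lim_lower k z : Cmod z <= rad (S k) ->
  a (S k) * mu (S k) * (Cmod z ^ (freq (S k) - 1) * Cmod (S' k z)
     - (8 * B * kappa + 8 * B + 2 * D) / INR L)
  <= Cmod (drs_lim z).
Proof.
  intros hz. assert (hr := rad_range (S k)). set (j := S k) in *.
  assert (hz1 : Cmod z <= 1) by lra.
  assert (h := ha j). assert (hm := mu_ge_1 j).
  destruct (jets_ok_all j) as [HP _]. destruct (HP z z hz1 hz1) as (_ & bP & _).
  destruct (jet_diff k (jets_ok_all k) z z hz1 hz1) as (_ & bS & _).
  assert (bQ : mu j * (Cmod z ^ (freq j - 1) * Cmod (S' k z)) - 8 * B * mu k
               <= Cmod (Q' j z)).
  { change (Q' j z) with (INR (freq j) * z ^ (freq j - 1) * S' k z + z ^ freq j * dS k z)%C.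
    replace (INR (freq j) * z ^ (freq j - 1) * S' k z + z ^ freq j * dS k z)%C
      with (INR (freq j) * z ^ (freq j - 1) * S' k z - (- (z ^ freq j * dS k z)))%C by ring.
    eapply Rle_trans; [|apply Cmod_sub_ge].
    rewrite Cmod_opp, !Cmod_mult, Cmod_R, !Cmod_pow, Rabs_pos_eq by apply pos_INR.
    fold (mu j). rewrite (Rmult_assoc (mu j)).
    assert (hp : Cmod z ^ freq j <= 1).
    { rewrite <- (pow1 (freq j)). apply pow_incr. split; [apply Cmod_ge_0 | lra]. }
    assert (0 <= Cmod z ^ freq j) by (apply pow_le, Cmod_ge_0).
    assert (0 <= Cmod (dS k z)) by apply Cmod_ge_0.
    assert (Cmod z ^ freq j * Cmod (dS k z) <= 8 * B * mu k) by nra.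
    lra. }
  assert (bT : Cmod (drs_lim z - (P' j z + a j * Q' j z)) <= 2 * D / INR L * a j * mu j).
  { apply Cconv_le with (fun i => P' (j + S i) z - (P' j z + a j * Q' j z))%C 0%nat.
    - apply Cconv_sub; [|apply Cconv_const].
      apply (Cconv_shift (fun n => P' n z) _ (fun i => (j + S i)%nat)); [intro; lia|].
      apply Clim_spec. eapply drs_fst_conv; eauto.
    - intros i _. destruct (jet_tail j i z z hz hz) as (_ & b & _).
      cbv beta in b. replace (j + 1)%nat with (S j) in b by lia.
      eapply Rle_trans; [exact b|].
      assert (0 <= (/ 2) ^ i) by (apply pow_le; lra).
      destruct D_ratio as [hD _].
      assert (0 <= 2 * D / INR L * a j * mu j)
        by (apply Rmult_le_pos; [apply Rmult_le_pos|]; lra).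
      nra. }
  assert (tri : Cmod (a j * Q' j z) - Cmod (P' j z) - 2 * D / INR L * a j * mu j
                <= Cmod (drs_lim z)).
  { replace (drs_lim z) with ((a j * Q' j z - - P' j z)
        - - (drs_lim z - (P' j z + a j * Q' j z)))%C by ring.
    eapply Rle_trans; [|apply Cmod_sub_ge]. rewrite Cmod_opp.
    generalize (Cmod_sub_ge (a j * Q' j z) (- P' j z)). rewrite Cmod_opp. lra. }
  rewrite Cmod_mult, Cmod_R, Rabs_pos_eq in tri by lra.
  assert (e : mu j = INR L * mu k) by apply mu_S.
  eapply Rle_trans; [|exact tri].
  apply Rle_trans with (a j * (mu j * (Cmod z ^ (freq j - 1) * Cmod (S' k z)) - 8 * B * mu k)
     - 8 * B * kappa / INR L * a j * mu j - 2 * D / INR L * a j * mu j).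
  - apply Req_le. rewrite e. field. lra.
  - assert (a j * (mu j * (Cmod z ^ (freq j - 1) * Cmod (S' k z)) - 8 * B * mu k)
      <= a j * Cmod (Q' j z)) by (apply Rmult_le_compat_l; lra).
    lra.
Qed.

End OneStart.

(** * The determinant and the joint lower bound for two derivatives *)

Let s0 : C * C := (RtoC 0, RtoC 1).
Let s1 : C * C := (RtoC 1, RtoC 0).

Lemma start_0 : Cmod (fst s0) ^ 2 + Cmod (snd s0) ^ 2 <= 1.
Proof. unfold s0; cbn [fst snd]. rewrite Cmod_0, Cmod_1. lra. Qed.

Lemma start_1 : Cmod (fst s1) ^ 2 + Cmod (snd s1) ^ 2 <= 1.
Proof. unfold s1; cbn [fst snd]. rewrite Cmod_0, Cmod_1. lra. Qed.

Lemma freq_S_ge k : (2 * freq k <= freq (S k))%nat.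
Proof.
  apply INR_le. rewrite mult_INR. fold (mu k) (mu (S k)). rewrite mu_S.
  generalize (mu_ge_1 k). simpl (INR 2). nra.
Qed.

(* Each step of the recursion multiplies the determinant by [(1 + a_k^2) z^(m_(k+1))]. *)
Lemma rs_det_lower k z : Cmod z <= 1 ->
  exists n, (n <= 2 * freq k)%nat /\
    Cmod z ^ n <= Cmod (fst (rs s0 k z) * snd (rs s1 k z) - snd (rs s0 k z) * fst (rs s1 k z)).
Proof.
  intros hz. induction k as [|k (n & hn & IH)].
  - exists 0%nat. split; [lia|]. unfold s0, s1; cbn [rs fst snd pow].
    replace (0 * 0 - 1 * 1)%C with (- (1))%C by ring. rewrite Cmod_m1. lra.
  - exists (n + freq (S k))%nat. split.
    (* The exponent is the sum of the frequencies so far; lacunarity keeps it below twice the last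
       one. *)
    + generalize (freq_S_ge k). lia.
    + cbn [rs fst snd].
      set (p := fst (rs s0 k z)) in *. set (q := snd (rs s0 k z)) in *.
      set (p' := fst (rs s1 k z)) in *. set (q' := snd (rs s1 k z)) in *.
      replace ((p + a k * q) * (z ^ freq (S k) * (q' - a k * p'))
               - z ^ freq (S k) * (q - a k * p) * (p' + a k * q'))%C
        with (RtoC (1 + a k ^ 2) * z ^ freq (S k) * (p * q' - q * p'))%C
        by (rewrite RtoC_plus, RtoC_pow; ring).
      rewrite !Cmod_mult, Cmod_R, Cmod_pow, pow_add.
      assert (0 <= a k ^ 2) by apply pow2_ge_0. rewrite Rabs_pos_eq by lra.
      assert (0 <= Cmod z ^ freq (S k)) by (apply pow_le, Cmod_ge_0).
      assert (0 <= Cmod z ^ n) by (apply pow_le, Cmod_ge_0).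
      rewrite (Rmult_comm (Cmod z ^ n)).
      apply Rmult_le_compat; nra.
Qed.

Lemma bernoulli_lower (d : R) (m : nat) : 0 <= d <= 1 -> 1 - INR m * d <= (1 - d) ^ m.
Proof.
  intros hd. induction m as [|m IH]; [simpl; lra|].
  rewrite S_INR. simpl. assert (0 <= INR m * d) by (apply Rmult_le_pos; [apply pos_INR | lra]).
  assert (0 <= (1 - d) ^ m) by (apply pow_le; lra).
  assert ((1 - INR m * d) * (1 - d) <= (1 - d) ^ m * (1 - d)) by (apply Rmult_le_compat_r; lra).
  nra.
Qed.

Hypothesis hL_big : 16 * B * (8 * B * kappa + 8 * B + 2 * (27648 * B)) <= INR L.

Lemma drs_lim_pair_lower k z :
  1 - / (2 * mu (S k)) <= Cmod z <= rad (S k) ->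
  a (S k) * mu (S k) / (8 * B) <= Cmod (drs_lim s0 z) + Cmod (drs_lim s1 z).
Proof.
  intros [hz1 hz2].
  assert (H0 := drs_lim_lower s0 start_0 k z hz2).
  assert (H1 := drs_lim_lower s1 start_1 k z hz2).
  assert (hr := rad_range (S k)). assert (hz : Cmod z <= 1) by lra.
  assert (h := ha (S k)). assert (hm := mu_ge_1 (S k)).
  destruct (rs_det_lower k z hz) as (n & hn & hdet).
  set (p := fst (rs s0 k z)) in *. set (q := snd (rs s0 k z)) in *.
  set (p' := fst (rs s1 k z)) in *. set (q' := snd (rs s1 k z)) in *.
  set (r := Cmod z) in *.
  assert (hr0 : 0 <= r) by apply Cmod_ge_0.
  set (m := freq (S k)) in *.
  assert (hm1 : (1 <= m)%nat) by (apply INR_le; exact hm).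
  assert (hnm : (n <= m)%nat) by (generalize (freq_S_ge k); unfold m; lia).
  assert (hhalf : / 2 <= r ^ m).
  { assert (0 < / (2 * mu (S k)) <= 1).
    { split; [apply Rinv_0_lt_compat; lra|]. rewrite <- Rinv_1. apply Rinv_le_contravar; lra. }
    apply Rle_trans with ((1 - / (2 * mu (S k))) ^ m).
    - eapply Rle_trans; [|apply bernoulli_lower; lra].
      apply Req_le. unfold mu. fold m. field. unfold mu in hm. fold m in hm. lra.
    - apply pow_incr. lra. }
  set (d0 := Cmod (q - a k * p)) in *. set (d1 := Cmod (q' - a k * p')) in *.
  (* The determinant is taken after the rotation but before the multiplication by [z ^ m]: its
     entries are then the next [P], bounded by [B], and exactly the quantities [d0], [d1] of
     [drs_lim_lower]. *)
  assert (hd : r ^ n <= B * (d0 + d1)).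
  { assert (hP0 := rs_fst_le s0 start_0 (S k) z hz).
    assert (hP1 := rs_fst_le s1 start_1 (S k) z hz).
    cbn [rs fst] in hP0, hP1. fold p q p' q' in hP0, hP1.
    assert (e : (RtoC (1 + a k ^ 2) * (p * q' - q * p'))%C
       = ((p + a k * q) * (q' - a k * p') - (p' + a k * q') * (q - a k * p))%C)
      by (rewrite RtoC_plus, RtoC_pow; ring).
    apply (f_equal Cmod) in e. rewrite Cmod_mult, Cmod_R in e.
    assert (0 <= a k ^ 2) by apply pow2_ge_0. rewrite Rabs_pos_eq in e by lra.
    assert (t := Cmod_sub_le ((p + a k * q) * (q' - a k * p')) ((p' + a k * q') * (q - a k * p))).
    assert (t0 := Cmod_mult_le _ _ _ _ hP0 (Rle_refl d1)).
    assert (t1 := Cmod_mult_le _ _ _ _ hP1 (Rle_refl d0)).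
    fold d0 d1 in t0, t1. assert (0 <= Cmod (p * q' - q * p')) by apply Cmod_ge_0.
    nra. }
  assert (hmain : / (4 * B) <= r ^ (m - 1) * (d0 + d1)).
  { assert (0 <= r ^ (m - 1)) by (apply pow_le; lra).
    (* The exponents [m - 1] and [n <= m] add up to at most [2 m], and [r ^ m >= 1/2]. *)
    assert (hle : r ^ m * r ^ m <= r ^ (m - 1) * r ^ n).
    { rewrite <- !pow_add. replace (m + m)%nat with ((m - 1 + n) + (m + 1 - n))%nat by lia.
      rewrite (pow_add r (m - 1 + n)).
      assert (r ^ (m + 1 - n) <= 1) by (rewrite <- (pow1 (m + 1 - n)); apply pow_incr; lra).
      assert (0 <= r ^ (m - 1 + n)) by (apply pow_le; lra). nra. }
    assert (/ 4 <= r ^ m * r ^ m) by nra.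
    assert (r ^ (m - 1) * r ^ n <= r ^ (m - 1) * (B * (d0 + d1)))
      by (apply Rmult_le_compat_l; lra).
    apply Rmult_le_reg_r with B; [lra|].
    replace (/ (4 * B) * B) with (/ 4) by (field; lra). lra. }
  set (X := 8 * B * kappa + 8 * B + 2 * (27648 * B)) in *.
  (* Origin of the size of [L]: the errors of both functions together may cost half of the main term
     [1 / (4 B)]. *)
  assert (hX : 2 * (X / INR L) <= / (8 * B)).
  { apply Rmult_le_reg_r with (8 * B * INR L); [nra|].
    replace (2 * (X / INR L) * (8 * B * INR L)) with (16 * B * X) by (field; lra).
    replace (/ (8 * B) * (8 * B * INR L)) with (INR L) by (field; lra). exact hL_big. }
  assert (e8 : / (4 * B) = 2 * / (8 * B)) by (field; lra).
  eapply Rle_trans; [|apply Rplus_le_compat; [exact H0 | exact H1]].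
  rewrite <- Rmult_plus_distr_l. unfold Rdiv at 1.
  apply Rmult_le_compat_l; [apply Rmult_le_pos; lra|].
  fold X p q p' q'. fold d0 d1. lra.
Qed.

End RudinShapiro.

(** * Disjoint cells below an integrable weight *)

Lemma sumR_ext n (u v : nat -> R) :
  (forall i, (i < n)%nat -> u i = v i) -> sumR n u = sumR n v.
Proof.
  intros H. induction n as [|n IH]; [reflexivity|]. simpl.
  rewrite IH, H; auto. 
Qed.

Lemma sumR_plus n (u v : nat -> R) :
  sumR n (fun i => u i + v i) = sumR n u + sumR n v.
Proof. induction n as [|n IH]; simpl; [ring | rewrite IH; ring]. Qed.

Lemma sumR_scal n c (u : nat -> R) : sumR n (fun i => c * u i) = c * sumR n u.
Proof. induction n as [|n IH]; simpl; [ring | rewrite IH; ring]. Qed.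

Lemma sumR_zero n (u : nat -> R) : (forall i, (i < n)%nat -> u i = 0) -> sumR n u = 0.
Proof.
  intros H. induction n as [|n IH]; [reflexivity|]. simpl. rewrite IH, H; auto; lra.
Qed.

Lemma sumR_at_most_one n (u : nat -> R) G : 0 <= G ->
  (forall i, (i < n)%nat -> u i <= G) ->
  (forall i j, (i < n)%nat -> (j < n)%nat -> i <> j -> u i = 0 \/ u j = 0) ->
  sumR n u <= G.
Proof.
  intros hG H D. induction n as [|n IH]; [exact hG|]. simpl.
  destruct (Req_dec (u n) 0) as [e|e].
  - rewrite e, Rplus_0_r. apply IH; auto.
  - rewrite sumR_zero; [rewrite Rplus_0_l; auto|].
    intros i hi. destruct (D i n) as [h|h]; auto; try lia. contradiction.
Qed.

(** An exceptional point inside the interval splits it in two; one outside is dropped from the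
    list. *)
Lemma increasing_off_finite (l : list R) (F : R -> R) u v : u <= v ->
  (forall x, u <= x <= v -> continuity_pt F x) ->
  (forall x, u < x < v -> ~ In x l -> exists d, 0 <= d /\ is_derive F x d) ->
  F u <= F v.
Proof.
  revert u v. induction l as [|c l IH]; intros u v huv Hc Hd.
  (* [Rmax 0] does not change the derivative in the open interval, and it keeps the sign even if the
     mean value point is an endpoint. *)
  - destruct (MVT_gen F u v (fun x => Rmax 0 (Derive F x))) as (c & _ & e).
    + rewrite Rmin_left, Rmax_right by lra. intros x hx.
      destruct (Hd x hx) as (d & h & hd); [intros []|].
      rewrite (is_derive_unique _ _ _ hd). rewrite Rmax_right by lra. exact hd.
    + rewrite Rmin_left, Rmax_right by lra. exact Hc.
    + assert (0 <= Rmax 0 (Derive F c)) by apply Rmax_l. nra.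
  - destruct (classic (u < c < v)) as [h|h].
    + apply Rle_trans with (F c); apply IH; try lra.
      * intros x hx. apply Hc. lra.
      * intros x hx hn. apply Hd; [lra|]. intros [e|e]; [lra | auto].
      * intros x hx. apply Hc. lra.
      * intros x hx hn. apply Hd; [lra|]. intros [e|e]; [lra | auto].
    + apply IH; auto. intros x hx hn. apply Hd; auto. intros [e|e]; [subst; auto | auto].
Qed.

(** A primitive of [inside a b] off the two endpoints: integrals of step functions become increments
    of sums of [clamp], and no integral has to be defined. *)
Definition clamp (a b t : R) : R := Rmax a (Rmin t b).

(** Open at both ends, so that cells sharing an edge do not both count at a common point. *)
Definition inside (a b t : R) : R :=
  if Rlt_dec a t then if Rlt_dec t b then 1 else 0 else 0.

Lemma inside_neq_0 a b t : inside a b t <> 0 -> a < t < b.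
Proof. unfold inside. destruct (Rlt_dec a t), (Rlt_dec t b); intro h; try lra; now destruct h. Qed.

Lemma inside_range a b t : 0 <= inside a b t <= 1.
Proof. unfold inside. destruct (Rlt_dec a t), (Rlt_dec t b); lra. Qed.

Lemma clamp_continuous a b t : continuity_pt (clamp a b) t.
Proof.
  intros eps he. exists eps. split; [exact he|].
  intros x [_ hx]. simpl in *. unfold R_dist in *. eapply Rle_lt_trans; [|exact hx].
  unfold clamp, Rmin. destruct (Rle_dec x b), (Rle_dec t b); unfold Rmax, Rabs;
  repeat match goal with
  | |- context [Rle_dec ?x ?y] => destruct (Rle_dec x y)
  | |- context [Rcase_abs ?x] => destruct (Rcase_abs x) end; lra.
Qed.

Lemma clamp_derive a b t : a <= b -> t <> a -> t <> b ->
  is_derive (clamp a b) t (inside a b t).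
Proof.
  intros hab ha hb. unfold inside.
  destruct (Rlt_dec a t) as [h|h]; [destruct (Rlt_dec t b) as [k|k]|].
  - apply is_derive_ext_loc with (fun x => x); [|apply (is_derive_id t)].
    exists (mkposreal (Rmin (t - a) (b - t)) ltac:(apply Rmin_pos; lra)).
    intros y hy. unfold ball in hy; simpl in hy.
    unfold AbsRing_ball, abs, minus, plus, opp in hy; simpl in hy.
    apply Rabs_lt_between in hy.
    generalize (Rmin_l (t - a) (b - t)) (Rmin_r (t - a) (b - t)). intros.
    unfold clamp. rewrite Rmin_left by lra. rewrite Rmax_right; lra.
  - apply is_derive_ext_loc with (fun x => b); [|apply (is_derive_const b t)].
    exists (mkposreal (t - b) ltac:(lra)).
    intros y hy. unfold ball in hy; simpl in hy.
    unfold AbsRing_ball, abs, minus, plus, opp in hy; simpl in hy.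
    apply Rabs_lt_between in hy.
    unfold clamp. rewrite Rmin_right by lra. rewrite Rmax_right; lra.
  - apply is_derive_ext_loc with (fun x => a); [|apply (is_derive_const a t)].
    exists (mkposreal (a - t) ltac:(lra)).
    intros y hy. unfold ball in hy; simpl in hy.
    unfold AbsRing_ball, abs, minus, plus, opp in hy; simpl in hy.
    apply Rabs_lt_between in hy.
    unfold clamp. rewrite Rmin_left by lra. rewrite Rmax_left; lra.
Qed.

Lemma sum_clamp_continuous n (lo hi w : nat -> R) t :
  continuity_pt (fun t => sumR n (fun i => w i * clamp (lo i) (hi i) t)) t.
Proof.
  induction n as [|n IH]; simpl.
  - apply continuity_pt_const. intros x y. reflexivity.
  - apply (continuity_pt_plus (fun t => sumR n (fun i => w i * clamp (lo i) (hi i) t))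
             (fun t => w n * clamp (lo n) (hi n) t)); [exact IH|].
    apply (continuity_pt_scal (clamp (lo n) (hi n)) (w n)). apply clamp_continuous.
Qed.

Lemma sum_clamp_derive n (lo hi w : nat -> R) t :
  (forall i, (i < n)%nat -> lo i <= hi i /\ t <> lo i /\ t <> hi i) ->
  is_derive (fun t => sumR n (fun i => w i * clamp (lo i) (hi i) t)) t
    (sumR n (fun i => w i * inside (lo i) (hi i) t)).
Proof.
  intros H. induction n as [|n IH]; simpl.
  - apply (is_derive_const 0 t).
  - apply (is_derive_plus (fun t => sumR n (fun i => w i * clamp (lo i) (hi i) t))
             (fun t => w n * clamp (lo n) (hi n) t)).
    + apply IH. auto.
    + apply (is_derive_scal (clamp (lo n) (hi n)) t (w n)).
      destruct (H n ltac:(lia)) as (h1 & h2 & h3). now apply clamp_derive.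
Qed.

(** The primitive is controlled on an open interval only; finitely many strict inclusions yield a
    compact subinterval on which monotonicity can be applied. *)
Lemma common_bounds n (lo hi w : nat -> R) alpha beta : alpha < beta ->
  (forall i, (i < n)%nat -> w i <> 0 -> alpha < lo i /\ hi i < beta) ->
  exists u v, alpha < u <= v /\ v < beta /\
    forall i, (i < n)%nat -> w i <> 0 -> u <= lo i /\ hi i <= v.
Proof.
  intros hab. induction n as [|n IH]; intros H.
  - exists ((alpha + beta) / 2), ((alpha + beta) / 2). repeat split; try lra; lia.
  - destruct IH as (u & v & h1 & h2 & h3); [auto|].
    destruct (Req_dec (w n) 0) as [e|e].
    + exists u, v. repeat split; try lra.
      * destruct (Nat.eq_dec i n); [subst; contradiction|]. apply h3; auto; lia.
      * destruct (Nat.eq_dec i n); [subst; contradiction|]. apply h3; auto; lia.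
    + destruct (H n ltac:(lia) e) as [k1 k2].
      exists (Rmin u (lo n)), (Rmax v (hi n)).
      assert (m1 := Rmin_l u (lo n)). assert (m2 := Rmin_r u (lo n)).
      assert (m3 := Rmax_l v (hi n)). assert (m4 := Rmax_r v (hi n)).
      assert (alpha < Rmin u (lo n)) by (apply Rmin_glb_lt; lra).
      assert (Rmax v (hi n) < beta) by (apply Rmax_lub_lt; lra).
      repeat split; try lra; destruct (Nat.eq_dec i n); subst; try lra;
        destruct (h3 i ltac:(lia) ltac:(auto)); lra.
Qed.

(* The difference of [Phi] and the weighted sum of the clamping functions has nonnegative derivative
   off the endpoints, hence increases. *)
Lemma interval_packing n (lo hi w : nat -> R) (Phi phi : R -> R) alpha beta V :
  alpha < beta ->
  (forall i, (i < n)%nat -> lo i <= hi i) ->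
  (forall i, (i < n)%nat -> w i <> 0 -> alpha < lo i /\ hi i < beta) ->
  (forall t, alpha < t < beta -> is_derive Phi t (phi t)) ->
  (forall t t', alpha < t < beta -> alpha < t' < beta -> Phi t' - Phi t <= V) ->
  (forall t, alpha < t < beta -> sumR n (fun i => w i * inside (lo i) (hi i) t) <= phi t) ->
  sumR n (fun i => w i * (hi i - lo i)) <= V.
Proof.
  intros hab Hle Hin HPhi HV Hphi.
  destruct (common_bounds n lo hi w alpha beta hab Hin) as (u & v & h1 & h2 & h3).
  set (T := fun t => sumR n (fun i => w i * clamp (lo i) (hi i) t)).
  assert (HF : Phi u - T u <= Phi v - T v).
  { apply (increasing_off_finite (map lo (seq 0 n) ++ map hi (seq 0 n))
             (fun t => Phi t - T t)); [lra| |].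
    - intros x hx. apply (continuity_pt_minus Phi T).
      + apply derivable_continuous_pt. exists (phi x).
        apply is_derive_Reals, HPhi. lra.
      + apply sum_clamp_continuous.
    - intros x hx hn.
      exists (phi x - sumR n (fun i => w i * inside (lo i) (hi i) x)). split.
      + assert (k := Hphi x ltac:(lra)). lra.
      + apply (is_derive_minus Phi T).
        * apply HPhi. lra.
        * apply sum_clamp_derive. intros i hi0. split; [auto|].
          split; intro e; apply hn; apply in_or_app; subst x.
          -- left. apply in_map, in_seq. lia.
          -- right. apply in_map, in_seq. lia. }
  assert (HT : T v - T u = sumR n (fun i => w i * (hi i - lo i))).
  { unfold T. rewrite <- (Rmult_1_l (sumR n (fun i => w i * clamp (lo i) (hi i) u))).
    replace (sumR n (fun i => w i * clamp (lo i) (hi i) v) - 1 * sumR n (fun i => w i * clamp (lo i) (hi i) u))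
      with (sumR n (fun i => w i * clamp (lo i) (hi i) v) + (-1) * sumR n (fun i => w i * clamp (lo i) (hi i) u)) by ring.
    rewrite <- sumR_scal, <- sumR_plus. apply sumR_ext. intros i hi0.
    destruct (Req_dec (w i) 0) as [e|e]; [rewrite e; ring|].
    destruct (h3 i hi0 e) as [k1 k2]. assert (k3 := Hle i hi0).
    unfold clamp. rewrite (Rmin_right v) by lra. rewrite (Rmin_left u) by lra.
    rewrite (Rmax_right (lo i) (hi i)) by lra. rewrite (Rmax_left (lo i) u) by lra. ring. }
  rewrite <- HT. specialize (HV u v ltac:(lra) ltac:(lra)). lra.
Qed.

(** * A logarithmic weight that is integrable over the disc *)

Section LogIntegrable.

Context (s : R).
Hypothesis hs : 1 < s.

(* Primitive of [((ln (6/(1-t)))^(-s) / (1-t) + (ln (6/(1+t)))^(-s) / (1+t)) / 2], which dominates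
   [(ln (12/(1-t^2)))^(-s) / (1-t^2)] by partial fractions. *)
Let Phi (t : R) : R :=
  (Rpower (ln 6 - ln (1 + t)) (1 - s) - Rpower (ln 6 - ln (1 - t)) (1 - s)) / (2 * (s - 1)).
Let phi (t : R) : R :=
  (Rpower (ln 6 - ln (1 - t)) (- s) / (1 - t) + Rpower (ln 6 - ln (1 + t)) (- s) / (1 + t)) / 2.

Lemma ln_3_ge_1 : 1 <= ln 3.
Proof. rewrite <- (ln_exp 1). apply ln_le; [apply exp_pos | apply exp_le_3]. Qed.

(** [6 = 3 * 2], where [x] reaches 2 and [ln 3 >= 1]. A logarithm that is at least 1 stays away from
    the singularity of its negative powers. *)
Lemma log_ge_1 x : 0 < x <= 2 -> 1 <= ln 6 - ln x.
Proof.
  intros hx. assert (h := ln_3_ge_1).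
  assert (ln x <= ln 2) by (apply ln_le; lra).
  replace 6 with (3 * 2) by ring. rewrite ln_mult by lra. lra.
Qed.

Lemma Rpower_div x y : 0 < x -> Rpower x (y - 1) = Rpower x y / x.
Proof.
  intros hx. unfold Rminus. rewrite Rpower_plus, Rpower_Ropp, Rpower_1 by exact hx. reflexivity.
Qed.

Lemma Phi_derive t : -1 < t < 1 -> is_derive Phi t (phi t).
Proof.
  intros ht. assert (h1 := log_ge_1 (1 + t) ltac:(lra)). assert (h2 := log_ge_1 (1 - t) ltac:(lra)).
  unfold Phi, phi.
  replace (- s) with ((1 - s) - 1) by ring. rewrite !Rpower_div by lra.
  unfold Rpower. unfold Rminus in *. auto_derive; [repeat split; lra|].
  field. repeat split; lra.
Qed.

Lemma Phi_var t t' : -1 < t < 1 -> -1 < t' < 1 -> Phi t' - Phi t <= / (s - 1).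
Proof.
  assert (H : forall x, 0 < x <= 2 -> 0 < Rpower (ln 6 - ln x) (1 - s) <= 1).
  { intros x hx. split; [apply exp_pos|].
    assert (h := log_ge_1 x hx). apply Rle_trans with (Rpower (ln 6 - ln x) 0).
    - apply Rle_Rpower; lra.
    - rewrite Rpower_O; lra. }
  intros ht ht'. unfold Phi.
  assert (a1 := H (1 + t) ltac:(lra)). assert (a2 := H (1 - t) ltac:(lra)).
  assert (a3 := H (1 + t') ltac:(lra)). assert (a4 := H (1 - t') ltac:(lra)).
  apply Rmult_le_reg_r with (2 * (s - 1)); [lra|].
  replace (/ (s - 1) * (2 * (s - 1))) with 2 by (field; lra).
  unfold Rdiv. rewrite <- Rmult_minus_distr_r, Rmult_assoc, Rinv_l by lra. lra.
Qed.

(** [y = h * t] rescales a slice of half-height [h]. The constant is [12 = 6 * 2] because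
    [h^2 (1 - t^2)] is at most [2 (1 - t)] and [2 (1 + t)], so both logarithms in [phi] are below
    the one on the left. *)
Lemma log_weight_le h t : 0 < h <= 1 -> -1 < t < 1 ->
  Rpower (ln 12 - ln (h ^ 2 * (1 - t ^ 2))) (- s) / (h ^ 2 * (1 - t ^ 2)) <= phi t / h ^ 2.
Proof.
  intros hh ht. unfold phi.
  assert (h1 := log_ge_1 (1 + t) ltac:(lra)). assert (h2 := log_ge_1 (1 - t) ltac:(lra)).
  set (lam := ln 12 - ln (h ^ 2 * (1 - t ^ 2))).
  assert (ht2 : 0 < 1 - t ^ 2) by nra.
  assert (e12 : ln 12 = ln 6 + ln 2) by (rewrite <- ln_mult by lra; f_equal; ring).
  assert (hh2 : 0 < h ^ 2 <= 1) by nra.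
  assert (hp : 0 < h ^ 2 * (1 - t ^ 2)) by (apply Rmult_lt_0_compat; lra).
  assert (hp1 : h ^ 2 * (1 - t ^ 2) <= 1 - t ^ 2) by nra.
  assert (g1 : ln 6 - ln (1 - t) <= lam).
  { unfold lam. rewrite e12.
    assert (ln (h ^ 2 * (1 - t ^ 2)) <= ln (2 * (1 - t))) by (apply ln_le; nra).
    rewrite (ln_mult 2) in H by lra. lra. }
  assert (g2 : ln 6 - ln (1 + t) <= lam).
  { unfold lam. rewrite e12.
    assert (ln (h ^ 2 * (1 - t ^ 2)) <= ln (2 * (1 + t))) by (apply ln_le; nra).
    rewrite (ln_mult 2) in H by lra. lra. }
  assert (M : forall x, 1 <= x -> x <= lam -> Rpower lam (- s) <= Rpower x (- s)).
  { intros x hx hxl. rewrite !Rpower_Ropp. apply Rinv_le_contravar; [apply exp_pos|].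
    apply Rle_Rpower_l; lra. }
  assert (k1 := M _ h2 g1). assert (k2 := M _ h1 g2).
  replace (Rpower lam (- s) / (h ^ 2 * (1 - t ^ 2)))
    with ((Rpower lam (- s) / (1 - t) + Rpower lam (- s) / (1 + t)) / 2 / h ^ 2)
    by (field; repeat split; nra).
  apply Rmult_le_compat_r; [left; apply Rinv_0_lt_compat; lra|].
  apply Rmult_le_compat_r; [lra|].
  apply Rplus_le_compat; apply Rmult_le_compat_r; auto;
    left; apply Rinv_0_lt_compat; lra.
Qed.

Lemma phi_pos t : -1 < t < 1 -> 0 <= phi t.
Proof.
  intros ht. unfold phi, Rpower.
  apply Rmult_le_pos; [|lra].
  apply Rplus_le_le_0_compat; apply Rmult_le_pos;
    try (left; apply exp_pos); left; apply Rinv_0_lt_compat; lra.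
Qed.

Lemma in_disc_sq x y : in_disc (x, y) <-> x ^ 2 + y ^ 2 < 1.
Proof.
  unfold in_disc, Cnorm; cbn [fst snd].
  assert (h := pow2_ge_0 x). assert (k := pow2_ge_0 y). split; intro H.
  - apply Rnot_le_lt. intro n. apply (Rlt_not_le _ _ H).
    rewrite <- sqrt_1. apply sqrt_le_1; lra.
  - rewrite <- sqrt_1. apply sqrt_lt_1; lra.
Qed.

(* Slices the disc vertically: the weight has [y]-integral at most [V / sqrt (1 - x^2)]
   on the slice at [x], and this is integrable in [x]. *)
Lemma finite_disc_integral_log (g : Cpx -> R) (K : R) : 0 <= K ->
  (forall x y, in_disc (x, y) ->
    g (x, y) <= K * (Rpower (ln 12 - ln (1 - (x ^ 2 + y ^ 2))) (- s) / (1 - (x ^ 2 + y ^ 2)))) ->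
  finite_disc_integral g.
Proof.
  intros hK Hg.
  set (V := K / (s - 1)).
  assert (hV : 0 <= V) by (apply Rle_mult_inv_pos; lra).
  exists (8 * V * / PI). intros n c Hval Hdis.
  set (A := fun i => ca (c i)). set (A' := fun i => cb (c i)).
  set (D := fun i => cc (c i)). set (D' := fun i => cd (c i)). set (v := fun i => cv (c i)).
  assert (hyp : forall i, (i < n)%nat -> A i < A' i /\ D i < D' i /\ 0 <= v i /\
     forall x y, A i <= x <= A' i -> D i <= y <= D' i ->
       x ^ 2 + y ^ 2 < 1 /\ v i <= g (x, y)).
  { intros i hi. destruct (Hval i hi) as (k1 & k2 & k3 & k4). repeat split; auto;
    destruct (k4 x y) as [k5 k6]; auto. now apply in_disc_sq. }
  assert (sl : forall x, -1 < x < 1 ->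
    sumR n (fun i => v i * inside (A i) (A' i) x * (D' i - D i)) <= V * / sqrt (1 - x ^ 2)).
  { intros x hx. assert (hx2 : 0 < 1 - x ^ 2) by nra.
    set (h := sqrt (1 - x ^ 2)).
    assert (hh : 0 < h) by (apply sqrt_lt_R0; exact hx2).
    assert (hsq : h ^ 2 = 1 - x ^ 2) by (apply pow2_sqrt; lra).
    assert (hh1 : h <= 1).
    { assert (0 <= x ^ 2) by apply pow2_ge_0. nra. }
    assert (tr : forall y, - h < y < h -> -1 < y / h < 1).
    { intros y hy. split; [apply Rmult_lt_reg_r with h | apply Rmult_lt_reg_r with h]; auto;
      unfold Rdiv; rewrite Rmult_assoc, Rinv_l by lra; lra. }
    (* Rescaling turns the factor [h^(-2)] of the weight into [1 / h] for its primitive; this is the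
       source of [1 / sqrt (1 - x^2)]. *)
    apply (interval_packing n D D' (fun i => v i * inside (A i) (A' i) x)
             (fun y => K / h * Phi (y / h)) (fun y => K / h ^ 2 * phi (y / h)) (- h) h).
    - lra.
    - intros i hi. destruct (hyp i hi). lra.
    - intros i hi hw. destruct (hyp i hi) as (_ & k2 & k3 & k4).
      assert (hx' : A i < x < A' i).
      { apply inside_neq_0. intro e. apply hw. rewrite e. ring. }
      destruct (k4 x (D i)) as [k5 _]; [lra | lra |].
      destruct (k4 x (D' i)) as [k6 _]; [lra | lra |].
      split; apply Rnot_le_lt; intro; nra.
    - intros y hy.
      replace (K / h ^ 2 * phi (y / h)) with (K / h * (/ h * phi (y / h))) by (field; lra).
      apply (is_derive_scal (fun y => Phi (y / h)) y (K / h)).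
      apply (is_derive_comp Phi (fun y => y / h) y).
      + apply Phi_derive. auto.
      + auto_derive; [lra | field; lra].
    - intros y y' hy hy'. rewrite <- Rmult_minus_distr_l.
      assert (P := Phi_var (y / h) (y' / h) (tr y hy) (tr y' hy')).
      replace (V * / h) with (K / h * / (s - 1)) by (unfold V; field; lra).
      apply Rmult_le_compat_l; [apply Rle_mult_inv_pos; lra | exact P].
    - intros y hy.
      assert (hpos := phi_pos _ (tr y hy)).
      (* Disjointness of the cells: at most one of them has both indicators nonzero at [(x, y)]. *)
      apply sumR_at_most_one.
      + apply Rmult_le_pos; [apply Rle_mult_inv_pos; nra | exact hpos].
      + intros i hi. destruct (hyp i hi) as (_ & _ & k3 & k4).
        destruct (Req_dec (inside (A i) (A' i) x) 0) as [e|e].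
        { rewrite e. rewrite Rmult_0_r, Rmult_0_l.
          apply Rmult_le_pos; [apply Rle_mult_inv_pos; nra | exact hpos]. }
        destruct (Req_dec (inside (D i) (D' i) y) 0) as [e'|e'].
        { rewrite e'. rewrite Rmult_0_r.
          apply Rmult_le_pos; [apply Rle_mult_inv_pos; nra | exact hpos]. }
        apply inside_neq_0 in e, e'.
        destruct (k4 x y) as [k5 k6]; [lra | lra |].
        apply Rle_trans with (v i).
        { generalize (inside_range (A i) (A' i) x) (inside_range (D i) (D' i) y). intros.
          rewrite Rmult_assoc. rewrite <- (Rmult_1_r (v i)) at 2.
          apply Rmult_le_compat_l; nra. }
        eapply Rle_trans; [exact k6|]. eapply Rle_trans; [apply Hg, in_disc_sq, k5|].
        assert (W := log_weight_le h (y / h) ltac:(lra) (tr y hy)).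
        replace (h ^ 2 * (1 - (y / h) ^ 2)) with (1 - (x ^ 2 + y ^ 2)) in W.
        2:{ replace (h ^ 2 * (1 - (y / h) ^ 2)) with (h ^ 2 - y ^ 2) by (field; lra). lra. }
        replace (K / h ^ 2 * phi (y / h)) with (K * (phi (y / h) / h ^ 2)) by (field; lra).
        apply Rmult_le_compat_l; assumption.
      + intros i j hi hj hij.
        destruct (Req_dec (v i * inside (A i) (A' i) x * inside (D i) (D' i) y) 0) as [e|e]; [now left|].
        destruct (Req_dec (v j * inside (A j) (A' j) x * inside (D j) (D' j) y) 0) as [e'|e']; [now right|].
        exfalso.
        assert (i1 : A i < x < A' i) by (apply inside_neq_0; intro z; apply e; rewrite z; ring).
        assert (i2 : D i < y < D' i) by (apply inside_neq_0; intro z; apply e; rewrite z; ring).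
        assert (j1 : A j < x < A' j) by (apply inside_neq_0; intro z; apply e'; rewrite z; ring).
        assert (j2 : D j < y < D' j) by (apply inside_neq_0; intro z; apply e'; rewrite z; ring).
        destruct (Hdis i j hi hj hij) as [q|[q|[q|q]]];
          fold (A i) (A j) (A' i) (A' j) (D i) (D j) (D' i) (D' j) in q; lra. }
  (* On each half of the interval one of [1 / sqrt (1 + x)], [1 / sqrt (1 - x)] is at most 1, so
     their sum dominates the product; its primitive varies by at most 8, each root lying in
     [[0, 2]]. *)
  assert (tot : sumR n (fun i => v i * (D' i - D i) * (A' i - A i)) <= 8 * V).
  { apply (interval_packing n A A' (fun i => v i * (D' i - D i))
      (fun x => V * (2 * sqrt (1 + x) - 2 * sqrt (1 - x)))
      (fun x => V * (/ sqrt (1 + x) + / sqrt (1 - x))) (-1) 1).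
    - lra.
    - intros i hi. destruct (hyp i hi). lra.
    - intros i hi _. destruct (hyp i hi) as (k1 & k2 & k3 & k4).
      destruct (k4 (A i) (D i)) as [k5 _]; [lra | lra |].
      destruct (k4 (A' i) (D i)) as [k6 _]; [lra | lra |].
      split; apply Rnot_le_lt; intro; nra.
    - intros x hx.
      assert (p1 := sqrt_lt_R0 (1 + x) ltac:(lra)). assert (p2 := sqrt_lt_R0 (1 - x) ltac:(lra)).
      auto_derive; [repeat split; lra|].
      unfold Rminus in *. field. lra.
    - intros t t' ht ht'.
      assert (B : forall x, 0 <= x <= 2 -> 0 <= sqrt x <= 2).
      { intros x hx. split; [apply sqrt_pos|]. rewrite <- (sqrt_Rsqr 2) by lra.
        apply sqrt_le_1; unfold Rsqr; lra. }
      assert (b1 := B (1 + t) ltac:(lra)). assert (b2 := B (1 - t) ltac:(lra)).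
      assert (b3 := B (1 + t') ltac:(lra)). assert (b4 := B (1 - t') ltac:(lra)).
      rewrite <- Rmult_minus_distr_l, (Rmult_comm 8). apply Rmult_le_compat_l; lra.
    - intros x hx.
      apply Rle_trans with (V * / sqrt (1 - x ^ 2)).
      + eapply Rle_trans; [|apply (sl x hx)]. apply Req_le, sumR_ext. intros. ring.
      + apply Rmult_le_compat_l; [exact hV|].
        replace (1 - x ^ 2) with ((1 + x) * (1 - x)) by ring.
        rewrite sqrt_mult by lra. rewrite Rinv_mult.
        assert (p1 := sqrt_lt_R0 (1 + x) ltac:(lra)). assert (p2 := sqrt_lt_R0 (1 - x) ltac:(lra)).
        assert (q1 := Rinv_0_lt_compat _ p1). assert (q2 := Rinv_0_lt_compat _ p2).
        destruct (Rle_dec 0 x) as [hx0|hx0].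
        * assert (/ sqrt (1 + x) <= 1).
          { rewrite <- Rinv_1. apply Rinv_le_contravar; [lra|].
            rewrite <- sqrt_1 at 1. apply sqrt_le_1; lra. }
          nra.
        * assert (/ sqrt (1 - x) <= 1).
          { rewrite <- Rinv_1. apply Rinv_le_contravar; [lra|].
            rewrite <- sqrt_1 at 1. apply sqrt_le_1; lra. }
          nra. }
  rewrite (sumR_ext n _ (fun i => / PI * (v i * (D' i - D i) * (A' i - A i)))).
  - rewrite sumR_scal, (Rmult_comm (8 * V)). apply Rmult_le_compat_l; [|exact tot].
    left. apply Rinv_0_lt_compat, PI_RGT_0.
  - intros i _. unfold v, A, A', D, D', Rdiv. ring.
Qed.

End LogIntegrable.

(** * Cells on annuli *)

Definition cell_mass (k : cell) : R := cv k * (cb k - ca k) * (cd k - cc k) / PI.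

(* One disjoint family of rectangles inside [Reg] carries heights for [g0] and [g1] at the same time,
   so that on each rectangle only the larger of the two functions has to be used. *)
Definition paired_cells (g0 g1 : Cpx -> R) (Reg : R -> R -> Prop) (S : R) : Prop :=
  exists (n : nat) (K0 K1 : nat -> cell),
    (forall i, (i < n)%nat ->
       valid_cell g0 (K0 i) /\ valid_cell g1 (K1 i) /\
       ca (K1 i) = ca (K0 i) /\ cb (K1 i) = cb (K0 i) /\
       cc (K1 i) = cc (K0 i) /\ cd (K1 i) = cd (K0 i) /\
       forall x y, ca (K0 i) <= x <= cb (K0 i) -> cc (K0 i) <= y <= cd (K0 i) -> Reg x y) /\
    (forall i j, (i < n)%nat -> (j < n)%nat -> i <> j -> cells_disjoint (K0 i) (K0 j)) /\
    S <= sumR n (fun i => cell_mass (K0 i)) + sumR n (fun i => cell_mass (K1 i)).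

Lemma paired_cells_bounded g0 g1 :
  finite_disc_integral g0 -> finite_disc_integral g1 ->
  exists M, forall Reg S, paired_cells g0 g1 Reg S -> S <= M.
Proof.
  intros [M0 H0] [M1 H1]. exists (M0 + M1).
  intros Reg S (n & K0 & K1 & HK & HD & HS).
  eapply Rle_trans; [exact HS|]. apply Rplus_le_compat.
  - apply H0; [|exact HD]. intros i hi. apply HK, hi.
  - apply H1.
    + intros i hi. apply HK, hi.
    + intros i j hi hj hij. generalize (HD i j hi hj hij). unfold cells_disjoint.
      destruct (HK i hi) as (_ & _ & e1 & e2 & e3 & e4 & _).
      destruct (HK j hj) as (_ & _ & f1 & f2 & f3 & f4 & _).
      now rewrite e1, e2, e3, e4, f1, f2, f3, f4.
Qed.

Lemma paired_cells_mono g0 g1 (Reg Reg' : R -> R -> Prop) S :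
  (forall x y, Reg x y -> Reg' x y) ->
  paired_cells g0 g1 Reg S -> paired_cells g0 g1 Reg' S.
Proof.
  intros HR (n & K0 & K1 & HK & HD & HS). exists n, K0, K1.
  split; [|split]; auto. intros i hi.
  destruct (HK i hi) as (v0 & v1 & e1 & e2 & e3 & e4 & r).
  repeat (split; [assumption|]). auto.
Qed.

Lemma sumR_append n m (u v : nat -> R) :
  sumR (n + m) (fun i => if lt_dec i n then u i else v (i - n)%nat) = sumR n u + sumR m v.
Proof.
  induction m as [|m IH].
  - rewrite Nat.add_0_r; simpl. rewrite Rplus_0_r. apply sumR_ext. intros i hi.
    now destruct (lt_dec i n).
  - rewrite Nat.add_succ_r; simpl. rewrite IH.
    destruct (lt_dec (n + m) n); [lia|]. replace (n + m - n)%nat with m by lia. ring.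
Qed.

(* Rectangles without a common point are separated in one of the coordinates. *)
Lemma cells_disjoint_regions (k k' : cell) (Reg Reg' : R -> R -> Prop) :
  ca k < cb k -> cc k < cd k -> ca k' < cb k' -> cc k' < cd k' ->
  (forall x y, Reg x y -> Reg' x y -> False) ->
  (forall x y, ca k <= x <= cb k -> cc k <= y <= cd k -> Reg x y) ->
  (forall x y, ca k' <= x <= cb k' -> cc k' <= y <= cd k' -> Reg' x y) ->
  cells_disjoint k k'.
Proof.
  intros h1 h2 h3 h4 D H H'. unfold cells_disjoint.
  apply NNPP. intro n.
  assert (ca k' < cb k /\ ca k < cb k' /\ cc k' < cd k /\ cc k < cd k') as (n1 & n2 & n3 & n4).
  { repeat split; apply Rnot_le_lt; intro; apply n; auto. }
  assert (m1 := Rmax_l (ca k) (ca k')). assert (m2 := Rmax_r (ca k) (ca k')).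
  assert (m3 := Rmax_l (cc k) (cc k')). assert (m4 := Rmax_r (cc k) (cc k')).
  apply (D (Rmax (ca k) (ca k')) (Rmax (cc k) (cc k'))).
  - apply H; split; auto; apply Rmax_lub; lra.
  - apply H'; split; auto; apply Rmax_lub; lra.
Qed.

Lemma paired_cells_union g0 g1 (Reg Reg' : R -> R -> Prop) S S' :
  (forall x y, Reg x y -> Reg' x y -> False) ->
  paired_cells g0 g1 Reg S -> paired_cells g0 g1 Reg' S' ->
  paired_cells g0 g1 (fun x y => Reg x y \/ Reg' x y) (S + S').
Proof.
  intros D (n & K0 & K1 & HK & HD & HS) (n' & K0' & K1' & HK' & HD' & HS').
  exists (n + n')%nat.
  exists (fun i => if lt_dec i n then K0 i else K0' (i - n)%nat).
  exists (fun i => if lt_dec i n then K1 i else K1' (i - n)%nat).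
  split; [|split].
  - intros i hi. destruct (lt_dec i n) as [h|h].
    + destruct (HK i h) as (v0 & v1 & e1 & e2 & e3 & e4 & r).
      repeat (split; [assumption|]). auto.
    + destruct (HK' (i - n)%nat ltac:(lia)) as (v0 & v1 & e1 & e2 & e3 & e4 & r).
      repeat (split; [assumption|]). auto.
  - intros i j hi hj hij. destruct (lt_dec i n) as [h|h], (lt_dec j n) as [k|k].
    + now apply HD.
    + destruct (HK i h) as ((a1 & a2 & _) & _ & _ & _ & _ & _ & r).
      destruct (HK' (j - n)%nat ltac:(lia)) as ((b1 & b2 & _) & _ & _ & _ & _ & _ & r').
      now apply (cells_disjoint_regions _ _ Reg Reg').
    + destruct (HK j k) as ((a1 & a2 & _) & _ & _ & _ & _ & _ & r).
      destruct (HK' (i - n)%nat ltac:(lia)) as ((b1 & b2 & _) & _ & _ & _ & _ & _ & r').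
      apply (cells_disjoint_regions _ _ Reg' Reg); auto. intros x y h1 h2. eauto.
    + apply HD'; lia.
  - assert (T : forall F G : nat -> cell,
      sumR (n + n') (fun i => cell_mass (if lt_dec i n then F i else G (i - n)%nat))
      = sumR n (fun i => cell_mass (F i)) + sumR n' (fun i => cell_mass (G i))).
    { intros F G. rewrite <- (sumR_append n n' (fun i => cell_mass (F i)) (fun i => cell_mass (G i))).
      apply sumR_ext. intros i _. now destruct (lt_dec i n). }
    rewrite !T. lra.
Qed.

Lemma Cmod_between x y r1 r2 : 0 <= r1 -> 0 <= r2 ->
  r1 ^ 2 <= x ^ 2 + y ^ 2 <= r2 ^ 2 -> r1 <= Cmod (x, y) <= r2.
Proof.
  intros h1 h2 h. unfold Cmod; cbn [fst snd]. split.
  - rewrite <- (sqrt_pow2 r1) by exact h1. apply sqrt_le_1; nra.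
  - rewrite <- (sqrt_pow2 r2) by exact h2. apply sqrt_le_1; nra.
Qed.

Lemma sumR_const n c : sumR n (fun _ => c) = INR n * c.
Proof.
  induction n as [|n IH]; [simpl; ring|]. rewrite S_INR. simpl sumR. rewrite IH. ring.
Qed.

Definition annulus (m x y : R) : Prop := 1 - / (2 * m) <= Cmod (x, y) <= 1 - / (4 * m).

(* The squares are stacked along the arc [|z| = 1 - 1/(2m)], [0 <= y <= 1/2]. *)
Lemma paired_cells_annulus (g0 g1 : Cpx -> R) (m W : nat) (v : R) :
  (1 <= m)%nat -> (8 <= W)%nat -> 0 <= v ->
  (forall z, 0 <= g0 z) -> (forall z, 0 <= g1 z) ->
  let w := / (2 * INR W * INR m) in
  (forall X Y,
     (forall x y, X <= x <= X + w -> Y <= y <= Y + w -> annulus (INR m) x y) ->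
     (forall x y, X <= x <= X + w -> Y <= y <= Y + w -> v <= g0 (x, y)) \/
     (forall x y, X <= x <= X + w -> Y <= y <= Y + w -> v <= g1 (x, y))) ->
  paired_cells g0 g1 (annulus (INR m)) (v / (4 * INR W * INR m) / PI).
Proof.
  intros hm hW hv hg0 hg1 w H.
  apply le_INR in hm. apply le_INR in hW. simpl in hm.
  replace (INR 8) with 8 in hW by (simpl; ring).
  assert (hw : 0 < w) by (apply Rinv_0_lt_compat; nra).
  assert (im : 0 < / INR m <= 1).
  { split; [apply Rinv_0_lt_compat; lra|]. rewrite <- Rinv_1. apply Rinv_le_contravar; lra. }
  assert (hw16 : w <= / INR m / 16).
  { unfold w. replace (/ INR m / 16) with (/ (16 * INR m)) by (field; lra).
    apply Rinv_le_contravar; nra. }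
  assert (e2 : / (2 * INR m) = / INR m / 2) by (field; lra).
  assert (e4 : / (4 * INR m) = / INR m / 4) by (field; lra).
  set (r1 := 1 - / (2 * INR m)).
  assert (hr1 : / 2 <= r1 < 1) by (unfold r1; rewrite e2; lra).
  (* [W m] squares of side [w = 1 / (2 W m)] reach exactly the height 1/2. *)
  set (n := (W * m)%nat).
  assert (hn : INR n * w = / 2).
  { unfold n, w. rewrite mult_INR. field. lra. }
  (* The lower left corner lies on the inner circle, so the square extends outwards; the root is
     real because heights stay below [1/2 <= r1]. *)
  set (Y := fun i : nat => INR i * w). set (X := fun i => sqrt (r1 ^ 2 - Y i ^ 2)).
  assert (hY : forall i, (i < n)%nat -> 0 <= Y i /\ Y i + w <= / 2).
  { intros i hi. unfold Y. split; [apply Rmult_le_pos; [apply pos_INR | lra]|].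
    rewrite <- hn. apply le_INR in hi. rewrite S_INR in hi. nra. }
  assert (hX : forall i, (i < n)%nat -> 0 <= X i <= 1 /\ X i ^ 2 + Y i ^ 2 = r1 ^ 2).
  { intros i hi. destruct (hY i hi). unfold X.
    assert (0 <= r1 ^ 2 - Y i ^ 2) by nra.
    rewrite pow2_sqrt by assumption. repeat split; [apply sqrt_pos | | ring].
    apply Rle_trans with (sqrt 1); [apply sqrt_le_1; nra | rewrite sqrt_1; lra]. }
  assert (hann : forall i, (i < n)%nat -> forall x y,
    X i <= x <= X i + w -> Y i <= y <= Y i + w -> annulus (INR m) x y).
  { intros i hi x y hx hy. destruct (hY i hi), (hX i hi) as [h1 h2].
    apply Cmod_between; [fold r1; lra | rewrite e4; lra |]. fold r1.
    split; [nra|].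
    (* [5 w] exceeds the increment of the squared modulus over a square, and [w <= 1 / (16 m)],
       which is the purpose of [W >= 8], puts it below the gap of the squared radii. *)
    apply Rle_trans with (r1 ^ 2 + 5 * w).
    - assert (x ^ 2 <= (X i + w) ^ 2) by (apply pow_incr; lra).
      assert (y ^ 2 <= (Y i + w) ^ 2) by (apply pow_incr; lra).
      nra.
    - unfold r1. rewrite e2, e4. nra. }
  set (P := fun i => forall x y, X i <= x <= X i + w -> Y i <= y <= Y i + w -> v <= g0 (x, y)).
  (* Exactly one of the two heights is [v] and the other is 0, so the total mass does not depend on
     which function is the large one. *)
  set (c0 := fun i => if excluded_middle_informative (P i) then v else 0).
  set (c1 := fun i => if excluded_middle_informative (P i) then 0 else v).
  assert (hdisc : forall x y, annulus (INR m) x y -> in_disc (x, y)).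
  { intros x y [_ h]. unfold in_disc. change (Cnorm (x, y)) with (Cmod (x, y)).
    rewrite e4 in h. lra. }
  exists n, (fun i => mkCell (X i) (X i + w) (Y i) (Y i + w) (c0 i)),
    (fun i => mkCell (X i) (X i + w) (Y i) (Y i + w) (c1 i)).
  split; [|split].
  - intros i hi. unfold valid_cell. cbn [ca cb cc cd cv].
    assert (hann' := hann i hi).
    assert (V0 : 0 <= c0 i /\ 0 <= c1 i).
    { unfold c0, c1. destruct (excluded_middle_informative (P i)); lra. }
    assert (V1 : forall x y, X i <= x <= X i + w -> Y i <= y <= Y i + w ->
      c0 i <= g0 (x, y) /\ c1 i <= g1 (x, y)).
    { intros x y hx hy. unfold c0, c1. destruct (excluded_middle_informative (P i)) as [p|p].
      - split; [now apply p | apply hg1].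
      - destruct (H (X i) (Y i) hann') as [q|q]; [contradiction|]. split; [apply hg0 | now apply q]. }
    split; [|split].
    1,2: split; [lra | split; [lra | split; [lra |]]]; intros x y hx hy;
      split; [auto | now apply V1].
    repeat (split; [reflexivity|]). exact hann'.
  - intros i j hi hj hij. unfold cells_disjoint. cbn [ca cb cc cd cv].
    unfold Y. destruct (Nat.lt_total i j) as [h|[h|h]]; [|contradiction|];
      apply le_INR in h; rewrite S_INR in h.
    + right; right; left. nra.
    + right; right; right. nra.
  - rewrite <- sumR_plus.
    rewrite (sumR_ext n _ (fun _ => v * w * w / PI)).
    + rewrite sumR_const. unfold Rdiv.
      replace (INR n * (v * w * w * / PI)) with ((INR n * w) * (v * w * / PI)) by ring.
      rewrite hn. apply Req_le. unfold w. field. repeat split; try lra. apply PI_neq0.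
    + intros i _. unfold cell_mass, c0, c1. cbn [ca cb cc cd cv].
      destruct (excluded_middle_informative (P i)); field; apply PI_neq0.
Qed.

(** * The two functions *)

Lemma jet_has_cderiv rho F F' c0 c1 c2 z :
  Cmod z < rho -> jet_bound rho F F' c0 c1 c2 -> has_cderiv F z (F' z).
Proof.
  intros hz J eps he.
  assert (hc : 0 < Rabs c2 + 1) by (generalize (Rabs_pos c2); lra).
  exists (Rmin (rho - Cmod z) (eps / (Rabs c2 + 1))). split.
  { apply Rmin_pos; [lra | now apply Rdiv_lt_0_compat]. }
  intros h [h0 h1]. change C in (type of h).
  change (Cmod (F (z + h)%C - F z - h * F' z) <= eps * Cmod h).
  change (Cnorm h) with (Cmod h) in h0, h1.
  assert (b1 := Rmin_l (rho - Cmod z) (eps / (Rabs c2 + 1))).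
  assert (b2 := Rmin_r (rho - Cmod z) (eps / (Rabs c2 + 1))).
  assert (t := Cmod_triangle z h).
  destruct (J z (z + h)%C ltac:(lra) ltac:(lra)) as (_ & _ & _ & _ & E).
  replace (z + h - z)%C with h in E by ring.
  eapply Rle_trans; [exact E|].
  assert (b3 : (Rabs c2 + 1) * Cmod h <= eps).
  { apply Rmult_le_reg_r with (/ (Rabs c2 + 1)); [now apply Rinv_0_lt_compat|].
    replace ((Rabs c2 + 1) * Cmod h * / (Rabs c2 + 1)) with (Cmod h) by (field; lra).
    unfold Rdiv in b2. lra. }
  generalize (Rle_abs c2). nra.
Qed.

Lemma has_cderiv_unique (f : C -> C) (z d d' : C) : has_cderiv f z d -> has_cderiv f z d' -> d = d'.
Proof.
  intros H H'.
  assert (e : Cmod (d - d') = 0).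
  { apply Rle_antisym; [|apply Cmod_ge_0]. apply le_epsilon. intros eps he.
    destruct (H (eps / 2)) as (r & hr & K); [lra|].
    destruct (H' (eps / 2)) as (r' & hr' & K'); [lra|].
    set (t := Rmin r r' / 2).
    assert (b := Rmin_pos r r' hr hr'). assert (b1 := Rmin_l r r'). assert (b2 := Rmin_r r r').
    assert (ht : Cmod (RtoC t) = t) by (rewrite Cmod_R; apply Rabs_pos_eq; unfold t; lra).
    assert (k := K (RtoC t)). assert (k' := K' (RtoC t)).
    change (Cnorm (RtoC t)) with (Cmod (RtoC t)) in k, k'. rewrite ht in k, k'.
    specialize (k ltac:(unfold t; lra)). specialize (k' ltac:(unfold t; lra)).
    change (Cmod (f (z + t)%C - f z - t * d) <= eps / 2 * t) in k.
    change (Cmod (f (z + t)%C - f z - t * d') <= eps / 2 * t) in k'.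
    assert (T := Cmod_sub_le (f (z + t)%C - f z - t * d') (f (z + t)%C - f z - t * d)).
    replace (f (z + t)%C - f z - t * d' - (f (z + t)%C - f z - t * d))%C
      with (t * (d - d'))%C in T by ring.
    rewrite Cmod_mult, ht in T.
    apply Rmult_le_reg_l with t; unfold t in *; lra. }
  apply Cmod_eq_0 in e. replace d with (d - d' + d')%C by ring. rewrite e. ring.
Qed.

Lemma rpow_nonneg x a : 0 <= rpow x a.
Proof. unfold rpow. destruct (Rle_dec x 0); [lra | left; apply exp_pos]. Qed.

Lemma rpow_pos_eq x a : 0 < x -> rpow x a = Rpower x a.
Proof. intros h. unfold rpow. destruct (Rle_dec x 0); [lra | reflexivity]. Qed.

Lemma finite_disc_integral_ext (g g' : Cpx -> R) :
  (forall z, in_disc z -> g z = g' z) -> finite_disc_integral g -> finite_disc_integral g'.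
Proof.
  intros e [M H]. exists M. intros n K HK. apply H. intros i hi.
  destruct (HK i hi) as (h1 & h2 & h3 & h4). repeat (split; [assumption|]).
  intros x y hx hy. destruct (h4 x y hx hy) as [d v]. split; [exact d|]. now rewrite e.
Qed.

(** [in_Dp] hides the derivative behind an existential; for the negative result, uniqueness of
    derivatives transfers the integral to the concrete [g]. *)
Lemma in_Dp_finite p f g : in_Dp p f -> analytic_with_deriv f g ->
  finite_disc_integral (fun z => rpow (1 - Cnorm z) (p - 1) * rpow (Cnorm (g z)) p).
Proof.
  intros (f' & H & F) G. revert F. apply finite_disc_integral_ext.
  intros z hz. now rewrite (has_cderiv_unique f z _ _ (H z hz) (G z hz)).
Qed.

Lemma least_nat (P : nat -> Prop) : (exists n, P n) ->
  exists n, P n /\ (n = 0%nat \/ exists j, n = S j /\ ~ P j).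
Proof.
  intros [n hn]. induction n as [|n IH].
  - exists 0%nat. auto.
  - destruct (classic (P n)) as [h|h]; [auto|]. exists (S n). eauto.
Qed.

Lemma harmonic_unbounded (M : R) : exists n, M < sumR n (fun k => / INR (k + 2)).
Proof.
  assert (H : forall n, ln (INR (n + 2)) - ln 2 <= sumR n (fun k => / INR (k + 2))).
  { induction n as [|n IH]; [simpl; replace (1 + 1) with 2 by ring; lra|].
    simpl sumR. replace (S n + 2)%nat with (S (n + 2)) by lia. rewrite S_INR.
    set (x := INR (n + 2)) in *.
    assert (hx : 0 < x) by (apply lt_0_INR; lia).
    assert (ln (x + 1) <= ln x + / x).
    { replace (x + 1) with (x * (1 + / x)) by (field; lra).
      assert (0 < / x) by now apply Rinv_0_lt_compat.
      rewrite ln_mult by lra. apply Rplus_le_compat_l.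
      rewrite <- (ln_exp (/ x)) at 2. apply ln_le; [lra | apply exp_ineq1_le]. }
    lra. }
  destruct (INR_unbounded (exp (M + ln 2))) as [n hn].
  exists n. eapply Rlt_le_trans; [|apply H].
  assert (M + ln 2 < ln (INR (n + 2))).
  { rewrite <- (ln_exp (M + ln 2)). apply ln_increasing; [apply exp_pos|].
    eapply Rlt_le_trans; [exact hn|]. apply le_INR. lia. }
  lra.
Qed.

(** The integral test for one term: the right-hand side is the integral of [u^(-t)] over
    [[x, x + 1]], obtained here from [exp y >= 1 + y] alone. *)
Lemma Rpower_telescope t x : 1 < t -> 0 < x ->
  Rpower (x + 1) (- t) <= (Rpower x (1 - t) - Rpower (x + 1) (1 - t)) / (t - 1).
Proof.
  intros ht hx.
  assert (hix : 0 < / (x + 1)) by (apply Rinv_0_lt_compat; lra).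
  assert (hln : ln x + / (x + 1) <= ln (x + 1)).
  { assert (k : 1 - / (x + 1) <= exp (- / (x + 1))) by (generalize (exp_ineq1_le (- / (x + 1))); lra).
    assert (k2 : ln (1 - / (x + 1)) <= - / (x + 1)).
    { rewrite <- (ln_exp (- / (x + 1))). apply ln_le; [|exact k].
      replace (1 - / (x + 1)) with (x / (x + 1)) by (field; lra).
      apply Rdiv_lt_0_compat; lra. }
    replace (1 - / (x + 1)) with (x / (x + 1)) in k2 by (field; lra).
    rewrite ln_div in k2 by lra. lra. }
  assert (key : Rpower (x + 1) (1 - t) * (1 + (t - 1) / (x + 1)) <= Rpower x (1 - t)).
  { unfold Rpower at 2.
    replace ((1 - t) * ln x) with ((1 - t) * ln (x + 1) + (t - 1) * (ln (x + 1) - ln x)) by ring.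
    rewrite exp_plus. fold (Rpower (x + 1) (1 - t)).
    apply Rmult_le_compat_l; [left; apply exp_pos|].
    eapply Rle_trans; [|apply exp_ineq1_le]. unfold Rdiv.
    apply Rplus_le_compat_l, Rmult_le_compat_l; lra. }
  replace (- t) with ((1 - t) - 1) by ring. rewrite Rpower_div by lra.
  apply Rmult_le_reg_r with (t - 1); [lra|].
  replace ((Rpower x (1 - t) - Rpower (x + 1) (1 - t)) / (t - 1) * (t - 1))
    with (Rpower x (1 - t) - Rpower (x + 1) (1 - t)) by (field; lra).
  unfold Rdiv in *. lra.
Qed.

(** * The coefficients [(k+1)^(-1/q)] and the constants that they determine *)

Section Construction.

Context (q : R).
Hypothesis hq : 0 < q < 2.

Let alpha := / q.
(** [a k ^ 2 = (k + 1)^(- t)], and [q < 2] says exactly that [t > 1]. *)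
Let t := 2 * alpha.
(** From [(k + 2) / (k + 1) <= 2]. *)
Let kappa := Rpower 2 alpha.
Let a (k : nat) : R := Rpower (INR (S k)) (- alpha).
(** [B ^ 2 = exp (1 + 1 / (t - 1))], the exponent being the integral-test bound for the sum of all
    [a k ^ 2]. *)
Let B := exp ((1 + / (t - 1)) / 2).

Fixpoint energy (k : nat) : R :=
  match k with O => 1 | S k => (1 + a k ^ 2) * energy k end.

Lemma alpha_pos : 0 < alpha.
Proof. apply Rinv_0_lt_compat. lra. Qed.

Lemma t_gt_1 : 1 < t.
Proof.
  unfold t, alpha. apply Rmult_lt_reg_r with q; [lra|].
  replace (2 * / q * q) with 2 by (field; lra). lra.
Qed.

Lemma kappa_ge_1 : 1 <= kappa.
Proof.
  unfold kappa. rewrite <- (Rpower_O 2) by lra.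
  generalize alpha_pos. intro. apply Rle_Rpower; lra.
Qed.

Lemma B_ge_1 : 1 <= B.
Proof.
  unfold B. assert (0 < / (t - 1)) by (apply Rinv_0_lt_compat; generalize t_gt_1; lra).
  eapply Rle_trans; [|apply exp_ineq1_le]. lra.
Qed.

Lemma INR_S_ge_1 k : 1 <= INR (S k).
Proof. apply (le_INR 1). lia. Qed.

Lemma Rpower_neg_anti x y b : 0 < x <= y -> 0 <= b -> Rpower y (- b) <= Rpower x (- b).
Proof.
  intros h hb. rewrite !Rpower_Ropp. apply Rinv_le_contravar; [apply exp_pos|].
  apply Rle_Rpower_l; lra.
Qed.

Lemma a_range k : 0 < a k <= 1.
Proof.
  split; [apply exp_pos|]. unfold a.
  apply Rle_trans with (Rpower 1 (- alpha)).
  - apply Rpower_neg_anti; generalize (INR_S_ge_1 k) alpha_pos; lra.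
  - unfold Rpower. rewrite ln_1, Rmult_0_r, exp_0. lra.
Qed.

Lemma a_dec k : a (S k) <= a k.
Proof.
  unfold a. apply Rpower_neg_anti; [|generalize alpha_pos; lra].
  split; [generalize (INR_S_ge_1 k); lra | apply le_INR; lia].
Qed.

Lemma a_slow k : a k <= kappa * a (S k).
Proof.
  unfold a, kappa. assert (h := INR_S_ge_1 k).
  replace (Rpower 2 alpha) with (Rpower (/ 2) (- alpha)).
  2:{ unfold Rpower. rewrite ln_Rinv by lra. f_equal. ring. }
  rewrite Rpower_mult_distr by (try lra; generalize (INR_S_ge_1 (S k)); lra).
  apply Rpower_neg_anti; [|generalize alpha_pos; lra].
  rewrite (S_INR (S k)). lra.
Qed.

Lemma a_pow_q k : Rpower (a k) q = / INR (S k).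
Proof.
  unfold a. rewrite Rpower_mult.
  replace (- alpha * q) with (Ropp 1) by (unfold alpha; field; lra).
  rewrite Rpower_Ropp, Rpower_1; [reflexivity|]. generalize (INR_S_ge_1 k). lra.
Qed.

Lemma a_sq k : a k ^ 2 = Rpower (INR (S k)) (- t).
Proof.
  rewrite <- Rpower_pow by apply a_range. unfold a. rewrite Rpower_mult. f_equal.
  unfold t. simpl. ring.
Qed.

Lemma energy_le k : energy k <= B ^ 2.
Proof.
  assert (ht := t_gt_1).
  assert (hB : B ^ 2 = exp (1 + / (t - 1))).
  { unfold B. rewrite <- exp_INR_mult. f_equal. simpl. field. lra. }
  assert (hi : 0 < / (t - 1)) by (apply Rinv_0_lt_compat; lra).
  (* Subtracting the remaining integral strengthens the bound, so that the induction telescopes. *)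
  assert (H : forall k, energy (S k) <= exp (1 + (1 - Rpower (INR (S k)) (1 - t)) / (t - 1))).
  { induction k0 as [|j IH].
    - cbn [energy]. rewrite a_sq. cbn [INR].
      assert (e : forall b, Rpower 1 b = 1).
      { intro b. unfold Rpower. rewrite ln_1, Rmult_0_r. apply exp_0. }
      rewrite !e. replace (1 + (1 - 1) / (t - 1)) with 1 by (field; lra).
      generalize (exp_ineq1_le 1). lra.
    - change (energy (S (S j))) with ((1 + a (S j) ^ 2) * energy (S j)).
      rewrite a_sq. rewrite (S_INR (S j)).
      assert (h := INR_S_ge_1 j). set (x := INR (S j)) in *.
      assert (T := Rpower_telescope t x ht ltac:(lra)).
      replace (1 + (1 - Rpower (x + 1) (1 - t)) / (t - 1))
        with ((Rpower x (1 - t) - Rpower (x + 1) (1 - t)) / (t - 1)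
              + (1 + (1 - Rpower x (1 - t)) / (t - 1))) by (field; lra).
      rewrite exp_plus.
      apply Rmult_le_compat; auto.
      + generalize (exp_pos (- t * ln (x + 1))). unfold Rpower. lra.
      + left. clear. induction j as [|j IH]; cbn [energy] in *.
        * generalize (pow2_ge_0 (a 0)). lra.
        * generalize (pow2_ge_0 (a (S j))). intro. apply Rmult_lt_0_compat; lra.
      + eapply Rle_trans; [apply exp_ineq1_le|].
        destruct T as [T|T]; [left; now apply exp_increasing | rewrite T; lra]. }
  rewrite hB.
  assert (mono : forall x y, x <= y -> exp x <= exp y).
  { intros x y [h|h]; [left; now apply exp_increasing | rewrite h; lra]. }
  destruct k as [|k].
  - cbn [energy]. eapply Rle_trans; [|apply exp_ineq1_le]. lra.
  - eapply Rle_trans; [apply H|]. apply mono.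
    assert (0 < Rpower (INR (S k)) (1 - t)) by apply exp_pos.
    unfold Rdiv. nra.
Qed.

Context (L : nat).
Hypothesis hL16 : 16 <= INR L.
Hypothesis hLk : 2 * kappa <= INR L.
Hypothesis hL_big : 16 * B * (8 * B * kappa + 8 * B + 2 * (27648 * B)) <= INR L.

Let mL := mu L.
Let rL := rad L.

Lemma rad_exhausts z : Cmod z < 1 -> exists k, Cmod z < rL k.
Proof.
  intros hz. destruct (INR_unbounded (/ (1 - Cmod z))) as [k hk]. exists k.
  assert (h : INR k <= mL k).
  { clear hk. unfold mL. induction k as [|k IH]; [rewrite mu_0; simpl; lra|].
    rewrite mu_S, S_INR. assert (h1 := mu_ge_1 L hL16 k). nra. }
  assert (h1 := mu_ge_1 L hL16 k). fold mL in h1.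
  unfold rL, rad. fold mL.
  assert (hp : 0 < / (1 - Cmod z)) by (apply Rinv_0_lt_compat; lra).
  assert (/ (4 * mL k) < 1 - Cmod z).
  { rewrite <- (Rinv_inv (1 - Cmod z)). apply Rinv_lt_contravar; nra. }
  lra.
Qed.

Section OneFunction.

Context (s : C * C).
Hypothesis hs : Cmod (fst s) ^ 2 + Cmod (snd s) ^ 2 <= 1.

Let f := rs_lim L a s.
Let g := drs_lim L a s.

Lemma jet_f k : jet_bound (rL k) f g B (4000 * B * a k * mL k) (4000 * B * a k * mL k ^ 2).
Proof.
  apply (jet_rs_lim L a B kappa energy hL16 hLk kappa_ge_1 B_ge_1 a_range a_dec a_slow
    eq_refl (fun _ => eq_refl) energy_le s hs).
Qed.

Lemma f_analytic : analytic_with_deriv f g.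
Proof.
  intros z hz. destruct (rad_exhausts z hz) as [k hk].
  eapply jet_has_cderiv; [exact hk | apply jet_f].
Qed.

Lemma f_Hinf : in_Hinf f.
Proof.
  split; [exists g; apply f_analytic|]. exists B. intros z hz.
  destruct (rad_exhausts z hz) as [k hk].
  destruct (jet_f k z z) as [h _]; try lra. exact h.
Qed.

(** [k] is the least index with [|z| <= rad k]. Minimality makes [1 - |z|] at most of order
    [1 / m_(k-1)], which costs the factor [L]; the lower bound on [1 - |z|] later turns decay in [k]
    into decay in a logarithm. *)
Lemma g_growth z : Cmod z < 1 ->
  exists k, (1 - Cmod z) * Cmod (g z) <= 4000 * B * INR L * a k /\ / (4 * mL k) <= 1 - Cmod z.
Proof.
  intros hz. destruct (rad_exhausts z hz) as [k0 hk0].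
  destruct (least_nat (fun k => Cmod z <= rL k)) as (k & hk & hmin); [exists k0; lra|].
  exists k. unfold rL, rad in hk. fold mL in hk. split; [|lra].
  assert (hk' : Cmod z <= rL k) by (unfold rL, rad; fold mL; exact hk).
  destruct (jet_f k z z hk' hk') as (_ & h & _).
  assert (hB := B_ge_1). assert (ha := a_range k).
  assert (hz0 := Cmod_ge_0 z). assert (hm := mu_ge_1 L hL16 k). fold mL in hm.
  assert (dm : (1 - Cmod z) * mL k <= INR L).
  { destruct hmin as [e|(j & e & n)].
    - subst k. unfold mL. rewrite mu_0. lra.
    - subst k. apply Rnot_le_lt in n. unfold rL, rad in n. fold mL in n.
      assert (hj := mu_ge_1 L hL16 j). fold mL in hj.
      replace (mL (S j)) with (INR L * mL j) by (symmetry; apply mu_S).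
      assert (k1 : (1 - Cmod z) * mL j <= 1).
      { apply Rle_trans with (/ (4 * mL j) * mL j).
        - apply Rmult_le_compat_r; lra.
        - replace (/ (4 * mL j) * mL j) with (/ 4) by (field; lra). lra. }
      nra. }
  apply Rle_trans with ((1 - Cmod z) * (4000 * B * a k * mL k)).
  - apply Rmult_le_compat_l; lra.
  - replace ((1 - Cmod z) * (4000 * B * a k * mL k))
      with (4000 * B * a k * ((1 - Cmod z) * mL k)) by ring.
    replace (4000 * B * INR L * a k) with (4000 * B * a k * INR L) by ring.
    apply Rmult_le_compat_l; [|exact dm]. apply Rmult_le_pos; lra.
Qed.

Lemma f_Dp p : q < p -> in_Dp p f.
Proof.
  intros hp. exists g. split; [apply f_analytic|].
  set (sp := p / q).
  assert (hsp : 1 < sp).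
  { unfold sp. apply Rmult_lt_reg_r with q; [lra|].
    replace (p / q * q) with p by (field; lra). lra. }
  assert (hB := B_ge_1).
  assert (hlnL : 0 <= ln (INR L)) by (rewrite <- ln_1; apply ln_le; lra).
  assert (h48 : 1 <= ln 48).
  { eapply Rle_trans; [exact ln_3_ge_1|]. apply ln_le; lra. }
  (* [1 - |z| >= 1 / (4 m_k)] gives [lam <= ln 12 + ln 4 + k * ln L <= H * (k + 1)]. *)
  set (H := ln 48 + ln (INR L)).
  assert (hH : 1 <= H) by (unfold H; lra).
  (* The factor 2 pays for replacing [1 - |z|] by [u = 1 - |z|^2] in the denominator. *)
  set (K := 2 * Rpower (4000 * B * INR L) p * Rpower H sp).
  assert (hK : 0 <= K).
  { unfold K, Rpower. repeat apply Rmult_le_pos; try lra; left; apply exp_pos. }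
  apply (finite_disc_integral_log sp hsp _ K hK).
  intros x y hxy. set (z := (x, y) : C).
  assert (hz : Cmod z < 1) by exact hxy.
  cbv beta. change (Cnorm (x, y)) with (Cmod z). change (Cnorm (g z)) with (Cmod (g z)).
  replace (x ^ 2 + y ^ 2) with (Cmod z ^ 2)
    by (unfold Cmod, z; cbn [fst snd]; rewrite pow2_sqrt; [reflexivity|]; nra).
  assert (hz0 := Cmod_ge_0 z).
  set (u := 1 - Cmod z ^ 2).
  assert (hu : 1 - Cmod z <= u <= 2 * (1 - Cmod z)) by (unfold u; nra).
  assert (hrhs : 0 <= K * (Rpower (ln 12 - ln u) (- sp) / u)).
  { apply Rmult_le_pos; [exact hK|]. apply Rle_mult_inv_pos; [left; apply exp_pos | lra]. }
  rewrite (rpow_pos_eq (1 - Cmod z)) by lra.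
  (* [Rpower 0 p] is 1, so zeros of [g] are settled by the convention [rpow 0 p = 0]. *)
  destruct (Rle_dec (Cmod (g z)) 0) as [h0|h0].
  { replace (rpow (Cmod (g z)) p) with 0; [rewrite Rmult_0_r; exact hrhs|].
    unfold rpow. destruct (Rle_dec (Cmod (g z)) 0); [reflexivity | contradiction]. }
  apply Rnot_le_lt in h0. rewrite rpow_pos_eq by exact h0.
  destruct (g_growth z hz) as (k & hk1 & hk2).
  assert (hm := mu_ge_1 L hL16 k). fold mL in hm.
  set (lam := ln 12 - ln u).
  assert (hlam0 : 0 < lam).
  { unfold lam. assert (ln u < ln 12) by (apply ln_increasing; nra). lra. }
  assert (hlam : lam <= H * INR (S k)).
  { assert (e1 : - ln u <= ln (4 * mL k)).
    { rewrite <- ln_Rinv by lra. apply ln_le; [apply Rinv_0_lt_compat; lra|].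
      rewrite <- (Rinv_inv (4 * mL k)). apply Rinv_le_contravar; [apply Rinv_0_lt_compat|]; lra. }
    assert (e2 : ln (mL k) = INR k * ln (INR L)).
    { unfold mL, mu, freq. rewrite pow_INR, ln_pow by lra. reflexivity. }
    rewrite ln_mult, e2 in e1 by lra.
    assert (e3 : ln 48 = ln 12 + ln 4) by (rewrite <- ln_mult by lra; f_equal; ring).
    unfold lam, H. rewrite S_INR. assert (hk := pos_INR k). nra. }
  assert (hak : Rpower (a k) p <= Rpower H sp * Rpower lam (- sp)).
  { unfold a. rewrite Rpower_mult.
    replace (- alpha * p) with (- sp) by (unfold sp, alpha; field; lra).
    replace (Rpower H sp) with (Rpower (/ H) (- sp)).
    2:{ unfold Rpower. rewrite ln_Rinv by lra. f_equal. ring. }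
    rewrite Rpower_mult_distr by (try apply Rinv_0_lt_compat; lra).
    apply Rpower_neg_anti; [|lra]. split.
    - apply Rmult_lt_0_compat; [apply Rinv_0_lt_compat|]; lra.
    - apply Rmult_le_reg_l with H; [lra|]. rewrite <- Rmult_assoc, Rinv_r by lra. lra. }
  assert (hpow : Rpower (1 - Cmod z) p * Rpower (Cmod (g z)) p
     <= Rpower (4000 * B * INR L) p * (Rpower H sp * Rpower lam (- sp))).
  { rewrite Rpower_mult_distr by lra.
    assert (ha := a_range k).
    apply Rle_trans with (Rpower (4000 * B * INR L * a k) p).
    - apply Rle_Rpower_l; [lra|]. split; [|exact hk1]. apply Rmult_lt_0_compat; lra.
    - rewrite <- Rpower_mult_distr; [| nra | lra].
      apply Rmult_le_compat_l; [left; apply exp_pos | exact hak]. }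
  rewrite Rpower_div by lra.
  set (X := Rpower (1 - Cmod z) p) in *. set (Y := Rpower (Cmod (g z)) p) in *.
  set (Z := Rpower (4000 * B * INR L) p) in *.
  set (V := Rpower lam (- sp)) in *.
  assert (hXY : 0 <= X * Y) by (unfold X, Y, Rpower; left; apply Rmult_lt_0_compat; apply exp_pos).
  replace (X / (1 - Cmod z) * Y) with (X * Y * / (1 - Cmod z)) by (field; lra).
  replace (K * (V / u)) with (Z * (Rpower H sp * V) * (2 * / u)) by (unfold K, Rdiv; fold Z; ring).
  apply Rmult_le_compat; [exact hXY | left; apply Rinv_0_lt_compat; lra | exact hpow |].
  apply Rmult_le_reg_r with ((1 - Cmod z) * u); [nra|].
  replace (/ (1 - Cmod z) * ((1 - Cmod z) * u)) with u by (field; lra).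
  replace (2 * / u * ((1 - Cmod z) * u)) with (2 * (1 - Cmod z)) by (field; lra). lra.
Qed.

End OneFunction.

Let s0 : C * C := (RtoC 0, RtoC 1).
Let s1 : C * C := (RtoC 1, RtoC 0).

Let weight (s : C * C) (z : Cpx) : R :=
  rpow (1 - Cnorm z) (q - 1) * rpow (Cnorm (drs_lim L a s z)) q.

(** [q - 1] has no fixed sign, so [(1 - |z|)^(q - 1)] is estimated as a power with exponent [q]
    divided by [1 - |z|]. The constant is [128 = 4 * 32], and [a k ^ q] becomes [1 / (k + 1)]. *)
Lemma weight_lower s k (z : C) : 
  / (4 * mL k) <= 1 - Cmod z <= / (2 * mL k) ->
  a k * mL k / (32 * B) <= Cmod (drs_lim L a s z) ->
  2 * Rpower (/ (128 * B)) q * mL k / INR (S k) <= weight s z.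
Proof.
  intros hz hg.
  assert (hm := mu_ge_1 L hL16 k). fold mL in hm.
  assert (ha := a_range k). assert (hB := B_ge_1).
  assert (hF : 0 < a k * mL k / (32 * B)).
  { apply Rdiv_lt_0_compat; [apply Rmult_lt_0_compat|]; lra. }
  assert (h4 : 0 < / (4 * mL k)) by (apply Rinv_0_lt_compat; lra).
  unfold weight. change (Cnorm z) with (Cmod z).
  change (Cnorm (drs_lim L a s z)) with (Cmod (drs_lim L a s z)).
  rewrite !rpow_pos_eq by lra. rewrite Rpower_div by lra.
  assert (p1 : Rpower (/ (4 * mL k)) q <= Rpower (1 - Cmod z) q) by (apply Rle_Rpower_l; lra).
  assert (p2 : Rpower (a k * mL k / (32 * B)) q <= Rpower (Cmod (drs_lim L a s z)) q)
    by (apply Rle_Rpower_l; lra).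
  assert (p3 : 2 * mL k <= / (1 - Cmod z)).
  { rewrite <- (Rinv_inv (2 * mL k)). apply Rinv_le_contravar; lra. }
  assert (e : 2 * Rpower (/ (128 * B)) q * mL k / INR (S k)
    = Rpower (/ (4 * mL k)) q * (2 * mL k) * Rpower (a k * mL k / (32 * B)) q).
  { unfold Rdiv. rewrite <- a_pow_q.
    replace (Rpower (/ (4 * mL k)) q * (2 * mL k) * Rpower (a k * mL k * / (32 * B)) q)
      with (2 * mL k * (Rpower (/ (4 * mL k)) q * Rpower (a k * mL k * / (32 * B)) q)) by ring.
    rewrite Rpower_mult_distr by lra.
    replace (/ (4 * mL k) * (a k * mL k * / (32 * B))) with (/ (128 * B) * a k) by (field; lra).
    rewrite <- Rpower_mult_distr; [ring | apply Rinv_0_lt_compat; lra | lra]. }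
  rewrite e. unfold Rdiv at 2.
  apply Rmult_le_compat; auto; try (left; apply exp_pos).
  - apply Rmult_le_pos; [left; apply exp_pos | lra].
  - apply Rmult_le_compat; auto; [left; apply exp_pos | lra].
Qed.

(** The joint lower bound is used at the corner [(X, Y)] only. The function that wins there has
    derivative at least [2 F], and the Lipschitz bound lets it lose at most [F] over so small a
    square. *)
Lemma annulus_dichotomy (W : nat) k X Y : 128000 * B ^ 2 <= INR W ->
  let w := / (2 * INR W * mL (S k)) in
  let v := 2 * Rpower (/ (128 * B)) q * mL (S k) / INR (S (S k)) in
  (forall x y, X <= x <= X + w -> Y <= y <= Y + w -> annulus (mL (S k)) x y) ->
  (forall x y, X <= x <= X + w -> Y <= y <= Y + w -> v <= weight s0 (x, y)) \/
  (forall x y, X <= x <= X + w -> Y <= y <= Y + w -> v <= weight s1 (x, y)).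
Proof.
  intros hW w v Hann.
  assert (hB := B_ge_1).
  assert (hm := mu_ge_1 L hL16 (S k)). fold mL in hm.
  assert (ha := a_range (S k)).
  assert (hW0 : 1 <= INR W) by nra.
  assert (hw : 0 < w) by (apply Rinv_0_lt_compat; nra).
  set (F := a (S k) * mL (S k) / (32 * B)).
  assert (near : forall s, Cmod (fst s) ^ 2 + Cmod (snd s) ^ 2 <= 1 ->
    2 * F <= Cmod (drs_lim L a s (X, Y)) ->
    forall x y, X <= x <= X + w -> Y <= y <= Y + w -> v <= weight s (x, y)).
  { intros s hs hbig x y hx hy.
    destruct (Hann x y hx hy) as [r1 r2]. destruct (Hann X Y) as [_ r2']; [lra | lra |].
    apply weight_lower; [lra|]. fold F.
    destruct (jet_f s hs (S k) (X, Y) (x, y)) as (_ & _ & _ & Lip & _);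
      [exact r2' | exact r2 |].
    assert (D : Cmod ((x, y) - (X, Y))%C <= 2 * w).
    { replace ((x, y) - (X, Y))%C with ((x - X)%R + Ci * (y - Y)%R)%C.
      - eapply Rle_trans; [apply Cmod_triangle|].
        rewrite Cmod_mult, Cmod_Ci, !Cmod_R, !Rabs_pos_eq by lra. lra.
      - apply injective_projections; simpl; ring. }
    assert (T := Cmod_sub_ge (drs_lim L a s (X, Y)) (drs_lim L a s (X, Y) - drs_lim L a s (x, y))).
    replace (drs_lim L a s (X, Y) - (drs_lim L a s (X, Y) - drs_lim L a s (x, y)))%C
      with (drs_lim L a s (x, y)) in T by ring.
    rewrite (Cmod_sub_sym (drs_lim L a s (X, Y))) in T.
    (* Origin of the condition on [W]: [128000 = 4000 * 32], the 32 coming from [F]. *)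
    assert (small : 4000 * B * a (S k) * mL (S k) ^ 2 * (2 * w) <= F).
    { replace (4000 * B * a (S k) * mL (S k) ^ 2 * (2 * w))
        with (F * (128000 * B ^ 2 / INR W)) by (unfold F, w; field; lra).
      rewrite <- (Rmult_1_r F) at 2. apply Rmult_le_compat_l.
      - unfold F. apply Rle_mult_inv_pos; [apply Rmult_le_pos|]; lra.
      - apply Rmult_le_reg_r with (INR W); [lra|]. unfold Rdiv.
        rewrite Rmult_assoc, Rinv_l; lra. }
    assert (c2 : 0 <= 4000 * B * a (S k) * mL (S k) ^ 2).
    { apply Rmult_le_pos; [apply Rmult_le_pos; lra | apply pow2_ge_0]. }
    assert (4000 * B * a (S k) * mL (S k) ^ 2 * Cmod ((x, y) - (X, Y))%C
       <= 4000 * B * a (S k) * mL (S k) ^ 2 * (2 * w)) by (apply Rmult_le_compat_l; lra).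
    lra. }
  assert (P := drs_lim_pair_lower L a B kappa energy hL16 hLk kappa_ge_1 B_ge_1 a_range a_dec
     a_slow eq_refl (fun _ => eq_refl) energy_le hL_big k (X, Y)).
  cbv zeta in P. fold s0 s1 in P. fold mL in P.
  specialize (P (Hann X Y ltac:(lra) ltac:(lra))).
  replace (a (S k) * mL (S k) / (8 * B)) with (4 * F) in P by (unfold F; field; lra).
  destruct (Rle_dec (2 * F) (Cmod (drs_lim L a s0 (X, Y)))) as [h|h].
  - left. now apply near; [apply start_0|].
  - right. apply near; [apply start_1|]. lra.
Qed.

Lemma not_both_Dp : ~ (in_Dp q (rs_lim L a s0) /\ in_Dp q (rs_lim L a s1)).
Proof.
  intros [H0 H1].
  assert (F0 := in_Dp_finite _ _ _ H0 (f_analytic s0 start_0)).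
  assert (F1 := in_Dp_finite _ _ _ H1 (f_analytic s1 start_1)).
  fold (weight s0) in F0. fold (weight s1) in F1.
  destruct (paired_cells_bounded _ _ F0 F1) as [M HM].
  assert (hB := B_ge_1).
  destruct (INR_unbounded (128000 * B ^ 2)) as [W hW].
  assert (hW8 : (8 <= W)%nat).
  { apply INR_le. replace (INR 8) with 8 by (simpl; ring). nra. }
  assert (hWp : 8 <= INR W).
  { apply le_INR in hW8. replace (INR 8) with 8 in hW8 by (simpl; ring). exact hW8. }
  (* The factor [m] of the height cancels against that of the area, so the [k]-th annulus carries
     mass [c / (k + 2)]. *)
  set (c := Rpower (/ (128 * B)) q / (2 * INR W) / PI).
  assert (hPI := PI_RGT_0).
  assert (hc : 0 < c).
  { unfold c. apply Rdiv_lt_0_compat; [apply Rdiv_lt_0_compat; [apply exp_pos | lra] | exact hPI]. }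
  assert (nonneg : forall s z, 0 <= weight s z).
  { intros s z. apply Rmult_le_pos; apply rpow_nonneg. }
  assert (one : forall k, paired_cells (weight s0) (weight s1) (annulus (mL (S k)))
                            (c * / INR (k + 2))).
  { intro k. assert (hm := mu_ge_1 L hL16 (S k)). fold mL in hm.
    replace (k + 2)%nat with (S (S k)) by lia.
    assert (hk := INR_S_ge_1 (S k)).
    set (v := 2 * Rpower (/ (128 * B)) q * mL (S k) / INR (S (S k))).
    replace (c * / INR (S (S k))) with (v / (4 * INR W * mL (S k)) / PI)
      by (unfold c, v; field; repeat split; lra).
    apply (paired_cells_annulus (weight s0) (weight s1) (freq L (S k)) W v); auto.
    - apply INR_le. exact hm.
    - unfold v. apply Rle_mult_inv_pos; [|lra].
      apply Rmult_le_pos; [|lra]. apply Rmult_le_pos; [lra | left; apply exp_pos].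
    - intros X Y HXY. apply (annulus_dichotomy W k X Y); [lra | exact HXY]. }
  assert (all : forall n, paired_cells (weight s0) (weight s1)
     (fun x y => Cmod (x, y) <= rL n) (sumR n (fun k => c * / INR (k + 2)))).
  { induction n as [|n IH].
    - exists 0%nat, (fun _ => mkCell 0 0 0 0 0), (fun _ => mkCell 0 0 0 0 0).
      simpl. repeat split; try lia; lra.
    - simpl sumR.
      assert (hm := mu_ge_1 L hL16 n). fold mL in hm.
      assert (hmS : mL (S n) = INR L * mL n) by apply mu_S.
      (* [L > 2] separates consecutive annuli; this allows a closed disc as the region of the
         induction. *)
      assert (gap : rL n < 1 - / (2 * mL (S n))).
      { unfold rL, rad. fold mL. rewrite hmS.
        assert (/ (2 * (INR L * mL n)) < / (4 * mL n)) by (apply Rinv_lt_contravar; nra). lra. }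
      assert (inc : 1 - / (2 * mL (S n)) <= rL (S n)).
      { unfold rL, rad. fold mL.
        assert (/ (4 * mL (S n)) <= / (2 * mL (S n))) by (apply Rinv_le_contravar; nra). lra. }
      assert (sep : forall x y, Cmod (x, y) <= rL n -> annulus (mL (S n)) x y -> False).
      { intros x y h [h' _]. lra. }
      refine (paired_cells_mono _ _ _ _ _ _ (paired_cells_union _ _ _ _ _ _ sep IH (one n))).
      intros x y [h|[h h']]; [lra | exact h']. }
  destruct (harmonic_unbounded (M / c)) as [n hn].
  assert (HMn := HM _ _ (all n)). rewrite sumR_scal in HMn.
  apply (Rmult_lt_compat_l c) in hn; [|exact hc].
  replace (c * (M / c)) with M in hn by (field; lra). lra.
Qed.

End Construction.

Theorem theorem4 (p q : R) (hq : 0 < q) (hqp : q < Rmin p 2) :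
  exists f : Cpx -> Cpx,
    (in_Dp p f /\ in_Hinf f) /\ ~ (in_Dp q f /\ in_Hinf f).
Proof.
  assert (hp : q < p) by (eapply Rlt_le_trans; [exact hqp | apply Rmin_l]).
  assert (hq2 : 0 < q < 2) by (split; [exact hq | eapply Rlt_le_trans; [exact hqp | apply Rmin_r]]).
  set (B := exp ((1 + / (2 * / q - 1)) / 2)).
  set (kappa := Rpower 2 (/ q)).
  destruct (INR_unbounded (Rmax 16 (Rmax (2 * kappa)
     (16 * B * (8 * B * kappa + 8 * B + 2 * (27648 * B)))))) as [L hL].
  assert (hL1 : 16 <= INR L) by (eapply Rle_trans; [apply Rmax_l | left; exact hL]).
  assert (hL' := Rle_trans _ _ _ (Rmax_r _ _) (Rlt_le _ _ hL)).
  assert (hL2 := Rle_trans _ _ _ (Rmax_l _ _) hL').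
  assert (hL3 := Rle_trans _ _ _ (Rmax_r _ _) hL').
  assert (N := not_both_Dp q hq2 L hL1 hL2 hL3). cbv zeta in N.
  (* The case distinction is classical: which of the two limits is the witness remains
     undetermined. *)
  apply not_and_or in N. destruct N as [N|N].
  - eexists. split; [split|].
    + apply (f_Dp q hq2 L hL1 hL2 _ start_0 p hp).
    + apply (f_Hinf q hq2 L hL1 hL2 _ start_0).
    + intros [h _]. exact (N h).
  - eexists. split; [split|].
    + apply (f_Dp q hq2 L hL1 hL2 _ start_1 p hp).
    + apply (f_Hinf q hq2 L hL1 hL2 _ start_1).
    + intros [h _]. exact (N h).
Qed.
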